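(* Let $q$ be an odd prime power and $d\ge 2$ an integer. Let $R \subseteq \mathbb{F}_q^*$, let $\Delta \geq 2$ be an integer, and denote $t = |R|$. Then every set $S \subseteq \mathbb{F}_q^d$ contains every $R$-distance tree $\mathcal{T}$ with at most $|S|-30 (t\Delta)^{1/2}q^{(d+1)/2}$ vertices and maximum $r$-degree $\Delta_r(\mathcal{T}) \leq \Delta$ for each $r \in R$.
   Context: For $x=(x_1,\ldots,x_d)\in\mathbb{F}_q^d$, define $\|x\| = x_1^2+\cdots+x_d^2\in\mathbb{F}_q$; the distance between $x,y\in\mathbb{F}_q^d$ is $\|x-y\|$. $\mathbb{F}_q^*=\mathbb{F}_q\setminus\{0\}$. For $R\subseteq \mathbb{F}_q^*$, an $R$-distance graph $\mathcal{H}$ is a (finite simple) graph $H$ together with a function $f:E(H)\to R$; it is an $R$-distance tree if $H$ is a tree. The $r$-degree of a vertex $v$ is the number of neighbors $u$ of $v$ in $H$ with $f(uv)=r$, and $\Delta_r(\mathcal{H})$ is the maximum of the $r$-degrees over all vertices of $H$. A set $S\subseteq\mathbb{F}_q^d$ contains $\mathcal{H}$ if there is an injective map $\phi:V(H)\to S$ such that $\|\phi(u)-\phi(v)\|=f(uv)$ for each edge $uv\in E(H)$. *)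

(* Defs.v *)
From HB Require Import structures.
From mathcomp Require Import all_boot all_order all_algebra.

Set Implicit Arguments.
Unset Strict Implicit.
Unset Printing Implicit Defensive.

Import GRing.Theory.
Local Open Scope ring_scope.

Definition qnorm (F : finFieldType) (d : nat) (x : 'rV[F]_d) : F :=
  \sum_(i < d) x 0 i ^+ 2.

Record sgraph := SGraph {
  vertex :> finType;
  adj : rel vertex;
  adj_sym : symmetric adj;
  adj_irrefl : irreflexive adj }.

Definition connected_graph (H : sgraph) : Prop :=
  (0 < #|H|)%N /\ forall u v : H, connect (@adj H) u v.

Definition acyclic_graph (H : sgraph) : Prop :=
  forall s : seq H, (2 < size s)%N -> ~ ucycle (@adj H) s.

Definition is_tree (H : sgraph) : Prop :=
  connected_graph H /\ acyclic_graph H.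

(* The function f : E(H) -> R is encoded as a binary function on vertices,
   only constrained (to be symmetric and R-valued), and only ever used, on
   adjacent pairs. *)
Record dist_graph (F : finFieldType) (R : {set F}) := DistGraph {
  dgraph :> sgraph;
  dlabel : dgraph -> dgraph -> F;
  dlabel_sym : forall u v, adj u v -> dlabel u v = dlabel v u;
  dlabel_in : forall u v, adj u v -> dlabel u v \in R }.

Section DistGraph.
Variables (F : finFieldType) (R : {set F}) (H : dist_graph R).

Definition rdegree (r : F) (v : H) : nat :=
  #|[set u : H | adj v u & dlabel v u == r]|.

Definition max_rdegree (r : F) : nat := (\max_(v : H) rdegree r v)%N.

Definition contains_dist_graph (d : nat) (S : {set 'rV[F]_d}) : Prop :=
  exists phi : H -> 'rV[F]_d,
    [/\ injective phi,
        forall v, phi v \in S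
      & forall u v, adj u v -> qnorm (phi u - phi v) = dlabel u v].

End DistGraph.

Arguments max_rdegree {F R} H r.
Arguments contains_dist_graph {F R} H {d} S.

(* Main.v *)
Require Import Defs.
From mathcomp Require Import all_boot all_order all_algebra.
From mathcomp Require Import all_fingroup all_solvable all_field all_character.
From mathcomp Require Import zify ring lra.
From mathcomp Require Import reals exp.
Set Implicit Arguments.
Unset Strict Implicit.
Unset Printing Implicit Defensive.
Import Order.TTheory GRing.Theory Num.Theory.
Local Open Scope ring_scope.

(** The tree is embedded one leaf at a time, and the embedding is kept in a
    state from which every remaining leaf can still be attached.

    Let q = #|F|, X = sqrt (t * Delta * q^(d+1)), and let m be the integer part
    of X / Delta.  Two ingredients are combined.

    Combinatorics.  A demand is a pair (x, r): the point x still needs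
    neighbours at distance r.  In the manner of Friedman, Pippenger and Haxell,
    if every set of at most 2m pairs has enough free neighbours to meet its
    demands, and sets of more than m pairs have some to spare, then any
    demanded leaf can be placed without destroying this property
    ([extend_online]); the sets that meet their demands with equality are
    closed under union, which is where submodularity enters.  As a tree is
    exhausted by adding leaves, it embeds ([embed_tree]).  All colours are
    treated at once, as sets of pairs: since one of the t colours carries a
    proportion 1/t of any set of pairs, t enters the expansion of large sets
    only as a factor ([sphere_nbhd_large]).  Expansion of the small sets is
    obtained by deleting from S the points of a maximal non-expanding set of
    pairs, at most m of them ([exists_expanding_subset]).

    Pseudorandomness.  Expansion of the large sets follows from mixing: if no
    point of A is at distance r <> 0 from a point of B then
    |A| |B| <= 4 q^(d+1) ([no_edge_mixing]).  Expanding the sphere of radius r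
    in additive characters, the coefficients are Salie sums when d is odd and
    Kloosterman sums when d is even, so what is needed is the Weil bound
    |K| <= 2 sqrt q ([kloosterman_bound]).

    The Weil bound is proved from scratch.  Over a quadratic extension, of
    cardinality Q^2, the Kloosterman sum K of a field of cardinality Q becomes
    2Q - K^2 ([kloosterman_doubling]).  Hence if |K| > 2 sqrt q held over F,
    then along the tower of degrees 2^J the sums divided by the square root of
    the cardinality of the field would tend to minus infinity
    ([doubling_unbounded]).  But averaging over the
    multiples of the character counts the points of y^q - y = a x + b / x, and
    Stepanov's method bounds that number from below with an error of the order
    of the square root of the cardinality ([stepanov], [trace_zero_count]);
    since from level one on the terms of the average are bounded above by twice
    that square root, none of them can be very negative.

    Finally 11 m Delta <= 11 X, which is below the slack 30 X. *)

(** * Online matching under submodular expansion *)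

Section OnlineMatching.
Local Open Scope nat_scope.
Variables (P V : finType) (N : P -> {set V}) (P0 : {set P}) (m : nat).
Implicit Types (X Y Z : {set P}) (U : {set V}) (b : P -> nat).

Definition nbhd X : {set V} := \bigcup_(p in X) N p.

(** Hall's condition, limited to sets of at most [2 * m] elements: the bound is
    twice that of [critical], so that two critical sets have an admissible
    union. *)
Definition extendable U b := forall X, X \subset P0 -> #|X| <= 2 * m ->
  \sum_(p in X) b p <= #|nbhd X :\: U|.

Definition expanding Delta lo hi k := forall X, X \subset P0 ->
  lo < #|X| <= hi -> Delta * #|X| + k <= #|nbhd X|.

Definition slack U b := forall X, X \subset P0 -> m < #|X| <= 2 * m ->
  \sum_(p in X) b p < #|nbhd X :\: U|.

Lemma nbhdU X Y : nbhd (X :|: Y) = nbhd X :|: nbhd Y.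
Proof. exact: bigcup_setU. Qed.

Lemma nbhdS X Y : X \subset Y -> nbhd X \subset nbhd Y.
Proof. by move=> sXY; rewrite -(setUidPr sXY) nbhdU subsetUl. Qed.

Lemma nbhd_submodular X Y U :
  #|nbhd (X :|: Y) :\: U| + #|nbhd (X :&: Y) :\: U|
    <= #|nbhd X :\: U| + #|nbhd Y :\: U|.
Proof.
rewrite nbhdU setDUl -[leqRHS]cardsUI leq_add2l subset_leq_card // -setDIl.
by rewrite setSD // subsetI !nbhdS ?subsetIl ?subsetIr.
Qed.

Lemma sum_modular X Y b :
  \sum_(p in X :|: Y) b p + \sum_(p in X :&: Y) b p
    = \sum_(p in X) b p + \sum_(p in Y) b p.
Proof.
have E Z : \sum_(p in Z) b p = \sum_p b p * (p \in Z).
  by rewrite big_mkcond; apply: eq_bigr => p _; case: (p \in Z); rewrite ?muln1 ?muln0.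
rewrite !E -!big_split; apply: eq_bigr => p _ /=; rewrite !inE.
by case: (p \in X); case: (p \in Y); rewrite /= ?muln0 ?muln1 ?addn0.
Qed.

Definition critical U b X :=
  [&& X \subset P0, #|X| <= m & #|nbhd X :\: U| <= \sum_(p in X) b p].

(** Demands are modular and free neighbourhoods submodular, so the union has no
    surplus either; as it has at most [2 * m] elements, the slack of the sets
    larger than [m] forces it to have at most [m]. *)
Lemma criticalU U b X Y : extendable U b -> slack U b ->
  critical U b X -> critical U b Y -> critical U b (X :|: Y).
Proof.
move=> ext large /and3P[sX cX tX] /and3P[sY cY tY].
have sXY : X :|: Y \subset P0 by rewrite subUset sX.
have cXY : #|X :|: Y| <= 2 * m by have := cardsU X Y; lia.
have tXY : #|nbhd (X :|: Y) :\: U| <= \sum_(p in X :|: Y) b p.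
  have := nbhd_submodular X Y U; have := sum_modular X Y b.
  have : \sum_(p in X :&: Y) b p <= #|nbhd (X :&: Y) :\: U|.
    apply: ext; first exact: subset_trans (subsetIl _ _) sX.
    by have := subset_leq_card (subsetIl X Y); lia.
  lia.
rewrite /critical sXY tXY andbT /=; case: leqP => // mXY.
by have := large _ sXY; rewrite mXY cXY ltnNge tXY => /(_ isT).
Qed.

(** If each free neighbour [y] of [p] spoils Hall's condition, it does so
    through a critical set that avoids [p] and sees [y].  The union [Z] of
    these sets is critical and sees all free neighbours of [p], so adding [p]
    to [Z] raises the demand but not the supply. *)
Lemma extend_online U b p : 0 < m -> extendable U b -> slack U b ->
  p \in P0 -> 0 < b p ->
  exists2 y, y \in N p :\: U & extendable (y |: U) (fun x => b x - (x == p)).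
Proof.
move=> m_gt0 ext large pP0 bp.
pose extb U' b' := [forall X : {set P}, (X \subset P0) && (#|X| <= 2 * m) ==>
  (\sum_(p in X) b' p <= #|nbhd X :\: U'|)].
have [/existsP[y /andP[yN /forallP ey]]|] := boolP
  [exists y, (y \in N p :\: U) && extb (y |: U) (fun x => b x - (x == p))].
  by exists y => // X sX cX; have := ey X; rewrite sX cX.
rewrite negb_exists => /forallP bad; exfalso.
pose Z := \bigcup_(X | critical U b X && (p \notin X)) X.
have /andP[critZ pZ] : critical U b Z && (p \notin Z).
  rewrite /Z; elim/big_ind: _ => //.
    rewrite /critical sub0set cards0 inE /= andbT /nbhd big_set0 set0D cards0 //.
  move=> X Y /andP[cX pX] /andP[cY pY]; rewrite criticalU //=.
  by rewrite !inE negb_or pX.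
have coverN : N p :\: U \subset nbhd Z :\: U.
  apply/subsetP => y yN; have := bad y; rewrite yN /=.
  case/forallPn => X; rewrite negb_imply -ltnNge => /andP[/andP[sX cX] lt_y].
  have yU : y \notin U by move: yN; rewrite inE => /andP[].
  have drop : #|nbhd X :\: U| = (y \in nbhd X) + #|nbhd X :\: (y |: U)|.
    by rewrite (cardsD1 y) !inE yU /= setUC setDDl.
  have extX := ext X sX cX.
  have [pX|pX] := boolP (p \in X).
    move: lt_y; rewrite (big_setD1 p pX) /= eqxx.
    rewrite (eq_bigr b); last by move=> x; rewrite !inE => /andP[/negPf-> _]; rewrite subn0.
    move: extX; rewrite (big_setD1 p pX) /=; lia.
  have sumX : \sum_(x in X) (b x - (x == p)) = \sum_(x in X) b x.
    apply: eq_bigr => x xX; case: eqP => [xp|]; last by rewrite subn0.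
    by rewrite xp (negPf pX) in xX.
  (* Otherwise using y would not change the supply of X. *)
  rewrite sumX in lt_y; have yNX : y \in nbhd X by lia.
  have critX : critical U b X.
    rewrite /critical sX /=; apply/andP; split; last by lia.
    case: leqP => // mX; have := large X sX; rewrite mX cX => /(_ isT); lia.
  rewrite !inE yU /=; apply/bigcupP; case/bigcupP: yNX => x xX yx.
  by exists x => //; apply/bigcupP; exists X => //; rewrite critX.
have /and3P[sZ cZ tZ] := critZ.
have spZ : p |: Z \subset P0 by rewrite subUset sub1set pP0.
have := ext _ spZ; rewrite cardsU1 pZ big_setU1 //= => ext_pZ.
move: ext_pZ; rewrite nbhdU {1}/nbhd big_set1 setDUl (setUidPr coverN); lia.
Qed.

End OnlineMatching.

(** * Growing a tree by leaves *)

Section TreeGrowth.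
Local Open Scope nat_scope.
Variable H : sgraph.
Implicit Types (W : {set H}) (u v w : H).

Definition inner W : rel H := [rel u v | [&& adj u v, u \in W & v \in W]].

Definition inner_connected W := forall u v, u \in W -> v \in W ->
  connect (inner W) u v.

Lemma inner_sym W : symmetric (inner W).
Proof. by move=> u v; rewrite /inner /= adj_sym; case: (u \in W); case: (v \in W). Qed.

Lemma inner_connectedU1 W v w : inner_connected W -> v \in W -> adj v w ->
  inner_connected (w |: W).
Proof.
move=> conW vW avw.
have sub : subrel (inner W) (connect (inner (w |: W))).
  move=> x y /and3P[/= a xW yW]; apply: connect1.
  by rewrite /inner /= a !inE xW yW !orbT.
have to_v x : x \in w |: W -> connect (inner (w |: W)) x v.
  rewrite !inE => /predU1P[->|xW]; last exact: connect_sub sub _ _ (conW _ _ xW vW).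
  by apply: connect1; rewrite /inner /= adj_sym avw !inE eqxx vW orbT.
move=> x y /to_v xv /to_v yv; apply: connect_trans xv _.
by rewrite (sym_connect_sym (@inner_sym _)).
Qed.

(** A second neighbour of [w] in the connected set [W] would close a cycle
    through [w]. *)
Lemma unique_attachment W v v' w : acyclic_graph H -> inner_connected W ->
  w \notin W -> v \in W -> v' \in W -> adj v w -> adj v' w -> v' = v.
Proof.
move=> acyc conW wW vW v'W avw av'w; apply/eqP; apply: contraT => ne.
have /connectP[p pth lst] := conW _ _ vW v'W.
case/shortenP: pth lst => p' pth uniq_p _ lst.
have inW x : x \in p' -> x \in W.
  elim: p' v {vW avw ne uniq_p lst} pth => //= y p' IH v0 /andP[/and3P[_ _ yW] pth].
  by rewrite inE => /predU1P[->//|]; apply: IH pth.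
case: (acyc (w :: v :: p')).
  by case: p' lst {pth uniq_p inW} => [/= e|//]; rewrite e eqxx in ne.
have path_adj : path (@adj H) v p'.
  by apply: sub_path pth => x y /= /and3P[].
apply/andP; split.
  by rewrite /= rcons_path path_adj -lst av'w adj_sym avw.
rewrite cons_uniq uniq_p andbT inE negb_or; apply/andP; split.
  by apply: contraNneq wW => ->.
by apply: contra wW; apply: inW.
Qed.

Lemma exists_boundary W : connected_graph H -> 0 < #|W| < #|H| ->
  exists v, exists2 w, v \in W /\ w \notin W & adj v w.
Proof.
case=> _ conn /andP[/card_gt0P[u uW] ltW].
have [w0 w0W] : exists w0, w0 \notin W.
  apply/existsP; rewrite -negb_forall; apply: contraL ltW => /forallP allW.
  by rewrite -leqNgt subset_leq_card //; apply/subsetP => x _.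
have /connectP[p pth lst] := conn u w0.
elim: p u uW pth lst => [|y p IH] u uW /= pth lst; first by rewrite lst uW in w0W.
case/andP: pth => auy pth.
have [yW|yW] := boolP (y \in W); first exact: IH yW pth lst.
by exists u, y.
Qed.

End TreeGrowth.

(** * Embedding a labelled tree in an expanding host *)

Section TreeEmbedding.
Local Open Scope nat_scope.
Variables (T : sgraph) (C : finType) (R : {set C}) (lab : T -> T -> C).
Variables (Delta m : nat) (V : finType) (S : {set V}) (N : V * C -> {set V}).
Hypothesis lab_sym : forall u v, adj u v -> lab u v = lab v u.
Hypothesis lab_in : forall u v, adj u v -> lab u v \in R.
Hypothesis N_S : forall p, N p \subset S.
Hypothesis N_sym : forall x y r, x \in S -> y \in N (x, r) -> x \in N (y, r).
Hypotheses (m_gt0 : 0 < m) (treeT : is_tree T).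
Hypothesis rdegT : forall r v, r \in R ->
  #|[set u | adj v u & lab v u == r]| <= Delta.

Let P0 := setX S R.

Hypothesis expand_small : expanding N P0 Delta 0 m 1.
Hypothesis expand_large : expanding N P0 Delta m (2 * m) #|T|.

Definition placed_nbrs (W : {set T}) v r :=
  [set u in W | adj v u && (lab v u == r)].

(** The demand [b (x, r)] starts at [Delta] everywhere and drops by one each
    time an [r]-edge is attached at [x] from the inside.  Only lower bounds are
    recorded: the edge through which a vertex was itself attached counts among
    its placed neighbours but is never subtracted from its demand. *)
Definition partial_embedding (W : {set T}) (f : T -> V) b :=
  [/\ inner_connected W, {in W &, injective f}, {in W, forall v, f v \in S},
      {in W &, forall u v, adj u v -> f v \in N (f u, lab u v)} &
      [/\ extendable N P0 m (f @: W) b, forall p, b p <= Delta,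
          forall v r, v \in W -> Delta <= b (f v, r) + #|placed_nbrs W v r| &
          forall y r, y \notin f @: W -> Delta <= b (y, r)]].

Lemma partial_embedding1 v x : x \in S ->
  partial_embedding [set v] (fun=> x) (fun=> Delta).
Proof.
move=> xS; split.
- by move=> y z; rewrite !inE => /eqP-> /eqP->; exact: connect0.
- by move=> y z; rewrite !inE => /eqP-> /eqP->.
- by [].
- by move=> y z; rewrite !inE => /eqP-> /eqP->; rewrite adj_irrefl.
split=> // [X sX cX|u r _]; last exact: leq_addr.
rewrite sum_nat_const imset_set1 mulnC.
have [->|X0] := eqVneq #|X| 0; first by rewrite muln0.
have lt_nbhd : Delta * #|X| < #|nbhd N X|.
  case: (leqP #|X| m) => cXm; first by rewrite -addn1 expand_small // lt0n X0.
  have /expand_large := sX; rewrite cXm cX => /(_ isT).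
  by have [T_gt0 _] := treeT.1; lia.
by have := cardsD1 x (nbhd N X); lia.
Qed.

(** The next vertex [w] has a single placed neighbour [v], so placing it is one
    request at the pair made of the image of [v] and the label of the edge;
    this pair has positive demand because [w] itself is a neighbour of [v] that
    is not yet placed. *)
Lemma partial_embedding_step W f b : partial_embedding W f b ->
  0 < #|W| < #|T| -> exists W' f' b',
  partial_embedding W' f' b' /\ #|W'| = #|W|.+1.
Proof.
case=> conW injf fS fN [ext bD bW bV] cW.
have [v [w [vW wW] avw]] := exists_boundary treeT.1 cW.
have attach v' : v' \in W -> adj v' w -> v' = v.
  by move=> v'W; apply: unique_attachment treeT.2 conW wW vW v'W avw.
set r := lab v w; pose p := (f v, r).
have rR : r \in R by exact: lab_in.
have pP0 : p \in P0 by rewrite inE /= fS.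
have bp : 0 < b p.
  have := bW v r vW; have := rdegT v rR.
  suff : #|placed_nbrs W v r| < #|[set u | adj v u & lab v u == r]|.
    by rewrite /p; lia.
  apply: proper_card; apply/properP; split.
    by apply/subsetP => u; rewrite !inE => /andP[_].
  by exists w; rewrite !inE ?(negPf wW) // avw eqxx.
have cardfW : #|f @: W| = #|W| by rewrite card_in_imset.
have large : slack N P0 m (f @: W) b.
  move=> X sX cX; have := expand_large sX cX; have := cardsID (f @: W) (nbhd N X).
  have := subset_leq_card (subsetIr (nbhd N X) (f @: W)).
  have : \sum_(x in X) b x <= Delta * #|X|.
    by rewrite mulnC -sum_nat_const leq_sum.
  by move: cW; rewrite cardfW; lia.
have [y] := extend_online m_gt0 ext large pP0 bp.
rewrite inE => /andP[yW yN] ext'.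
pose f' u := if u == w then y else f u.
have f'w : f' w = y by rewrite /f' eqxx.
have f'W u : u \in W -> f' u = f u.
  by rewrite /f'; case: eqP => // -> ; rewrite (negPf wW).
have yf u : u \in W -> y <> f u by move=> uW e; rewrite e imset_f in yW.
have imf' : f' @: (w |: W) = y |: f @: W.
  rewrite imsetU1 f'w; congr (_ |: _); exact: eq_in_imset.
have yS : y \in S by apply: subsetP yN.
exists (w |: W), f', (fun x => b x - (x == p)); split; last by rewrite cardsU1 wW.
split.
- exact: inner_connectedU1 conW vW avw.
- move=> u u'; rewrite !inE => /predU1P[->|uW] /predU1P[->|u'W] //.
  + by rewrite f'w f'W // => /yf.
  + by rewrite f'w f'W // => /esym/yf.
  + by rewrite !f'W //; apply: injf.
- by move=> u; rewrite !inE => /predU1P[->|uW]; rewrite ?f'w // f'W ?fS.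
- move=> u u'; rewrite !inE => /predU1P[->|uW] /predU1P[->|u'W].
  + by rewrite adj_irrefl.
  + move=> awu'; rewrite f'w f'W // (attach u') // 1?adj_sym //.
    rewrite lab_sym 1?adj_sym //; apply: N_sym => //; exact: fS.
  + by move=> auw; rewrite f'w f'W // (attach u).
  + by rewrite !f'W //; apply: fN.
split.
- by rewrite imf'.
- by move=> x; have := bD x; lia.
- move=> u s; rewrite !inE => /predU1P[->|uW].
    rewrite f'w; case: eqP => [[/esym e _]|_]; first by case: (yf v).
    by rewrite subn0; have := bV y s yW; lia.
  rewrite f'W //; have := bW u s uW.
  have mono : placed_nbrs W u s \subset placed_nbrs (w |: W) u s.
    by apply/subsetP => z; rewrite !inE => /andP[->]; rewrite orbT.
  case: eqP => [[e es]|_]; last by have := subset_leq_card mono; lia.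
  have uv : u = v by apply: injf.
  suff : #|placed_nbrs W u s| < #|placed_nbrs (w |: W) u s| by lia.
  apply: proper_card; rewrite properE mono /=; apply/subsetPn; exists w.
    by rewrite !inE eqxx uv avw es eqxx.
  by rewrite !inE (negPf wW).
- move=> x s; rewrite imf' !inE negb_or => /andP[xy xW].
  case: eqP => [[e _]|_]; last by rewrite subn0; apply: bV.
  by rewrite e imset_f in xW.
Qed.

Lemma embed_tree : S != set0 -> exists phi : T -> V,
  [/\ injective phi, forall v, phi v \in S &
      forall u v, adj u v -> phi v \in N (phi u, lab u v)].
Proof.
case/set0Pn => x xS; have [/card_gt0P[v0 _] _] := treeT.1.
have grow k : 0 < k <= #|T| ->
    exists W f b, partial_embedding W f b /\ #|W| = k.
  elim: k => // -[_ _|k IH /andP[_ lek]].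
    exists [set v0], (fun=> x), (fun=> Delta); rewrite cards1.
    by split => //; apply: partial_embedding1.
  have [|W [f [b [emb cW]]]] := IH; first exact: ltnW.
  have [|W' [f' [b' [emb' cW']]]] := partial_embedding_step emb; first by rewrite cW.
  by exists W', f', b'; rewrite cW' cW.
have [|W [f [b [[_ injf fS fN _] cW]]]] := grow #|T|.
  by rewrite leqnn andbT; case: treeT.1.
have WT u : u \in W.
  have /eqP-> : W == setT by rewrite eqEcard subsetT cardsT cW leqnn.
  by rewrite inE.
by exists f; split=> [u v e|v|u v]; [apply: injf| apply: fS | apply: fN].
Qed.

End TreeEmbedding.

(** * Passing to a subset in which small sets expand *)

Section Deletion.
Local Open Scope nat_scope.
Variables (V C : finType) (S : {set V}) (R : {set C}) (N : V * C -> {set V}).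
Variables (Delta m beta : nat).

Definition within (S' : {set V}) (p : V * C) := N p :&: S'.

Lemma nbhd_within S' X : nbhd (within S') X = nbhd N X :&: S'.
Proof. by rewrite /nbhd big_distrl. Qed.

Definition deficient (X : {set V * C}) :=
  [&& X \subset setX S R, #|X| <= m &
      #|(nbhd N X :&: S) :\: [set p.1 | p in X]| <= Delta * #|X|].

(** Remove the points of a largest deficient set [X] of pairs.  A set [Y] of at
    most [m] pairs that failed to expand in what remains would make the union
    of [X] and [Y] satisfy the same inequality: either it is again deficient,
    against maximality, or it has between [m] and [2 * m] elements, against the
    expansion of large sets.  Neighbours in the deleted points are discounted
    in [deficient], which is what makes the inequality add up. *)
Lemma exists_expanding_subset :
    (forall X : {set V * C}, X \subset setX S R -> m < #|X| ->
       #|S :\: nbhd N X| <= beta) ->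
    beta + 2 * m + Delta * (2 * m) < #|S| ->
  exists2 S' : {set V}, S' \subset S /\ #|S| <= #|S'| + m
    & expanding (within S') (setX S' R) Delta 0 m 1.
Proof.
move=> large ltS.
have bad0 : deficient set0.
  by rewrite /deficient sub0set cards0 /nbhd big_set0 set0I set0D cards0.
case: (@arg_maxnP _ set0 deficient (fun X => #|X|) bad0) => X /and3P[sX cX dX] maxX.
pose W := [set p.1 | p in X]; pose S' := S :\: W.
have cW : #|W| <= m by apply: leq_trans (leq_imset_card _ _) cX.
exists S'.
  rewrite subsetDl; split=> //; have := cardsID W S.
  by have := subset_leq_card (subsetIr S W); rewrite /S'; lia.
move=> Y sY /andP[Y0 cY]; rewrite addn1 ltnNge; apply/negP; rewrite nbhd_within => dY.
have disj : X :&: Y = set0.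
  apply/eqP; rewrite setI_eq0 -setI_eq0; apply/eqP/setP => p; rewrite !inE.
  apply/negP => /andP[pX pY]; have := subsetP sY p pY; rewrite !inE => /andP[/andP[pW _] _].
  by rewrite imset_f in pW.
have cZ : #|X :|: Y| = #|X| + #|Y| by rewrite cardsU disj cards0 subn0.
have sZ : X :|: Y \subset setX S R.
  rewrite subUset sX; apply: subset_trans sY _; apply/subsetP => p.
  by rewrite !inE => /andP[/andP[_ ->] ->].
have sub : (nbhd N (X :|: Y) :&: S) :\: [set p.1 | p in X :|: Y] \subset
    ((nbhd N X :&: S) :\: W) :|: (nbhd N Y :&: S').
  rewrite nbhdU imsetU; apply/subsetP => y; rewrite !inE -/W.
  case: (y \in W); case: (y \in S); case: (y \in nbhd N X); case: (y \in nbhd N Y);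
    by rewrite ?orbT ?andbF.
have dZ := leq_trans (subset_leq_card sub) (leq_trans (leq_card_setU _ _) (leq_add dX dY)).
rewrite -mulnDr -cZ in dZ.
have [cZm|mZ] := leqP #|X :|: Y| m.
  have := maxX (X :|: Y); rewrite /deficient sZ cZm dZ => /(_ isT); rewrite cZ.
  by move: Y0; clear; lia.
have := large _ sZ mZ.
set Z := X :|: Y in dZ mZ cZ *; set K := nbhd N Z.
have cZ2 : #|Z| <= 2 * m by rewrite cZ mul2n -addnn leq_add.
have cpZ : #|[set p.1 | p in Z]| <= #|Z| := leq_imset_card _ _.
have split_S : #|S| = #|K :&: S| + #|S :\: K| by rewrite -(cardsID K S) setIC.
have split_K : #|K :&: S| <= #|Z| + Delta * #|Z|.
  rewrite -(cardsID [set p.1 | p in Z] (K :&: S)) leq_add //.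
  exact: leq_trans (subset_leq_card (subsetIr _ _)) cpZ.
have : Delta * #|Z| <= Delta * (2 * m) by rewrite leq_mul2l cZ2 orbT.
rewrite split_S in ltS; move: ltS split_K cZ2; clear.
move: #|K :&: S| #|S :\: K| #|Z| (Delta * #|Z|) (Delta * (2 * m)) => *; lia.
Qed.

End Deletion.

(** * Finite fields and quadratic extensions *)

Lemma pchar_nat_card (F : finFieldType) : [pchar F].-nat #|F|.
Proof.
have [p pp chp] := finPcharP F.
have := pprimeChar_pgroup chp; rewrite /pgroup cardsT => pF.
by rewrite (eq_pnat _ (pcharf_eq chp)).
Qed.

Lemma odd_card_two_neq0 (F : finFieldType) : odd #|F| -> 2%:R != 0 :> F.
Proof.
move=> oddF; apply/eqP => two0.
have ch2 : 2%N \in [pchar F] by rewrite inE /= two0 eqxx.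
have := pchar_nat_card F; rewrite (eq_pnat _ (pcharf_eq ch2)).
case/p_natP => -[|k] cF; last by rewrite cF oddX in oddF.
by have := finNzRing_gt1 F; rewrite cF.
Qed.

Lemma exists_nonsquare (F : finFieldType) : odd #|F| ->
  exists c : F, forall x, x ^+ 2 != c.
Proof.
move=> oddF; have two0 := odd_card_two_neq0 oddF.
have [/existsP[c /forallP cP]|] := boolP [exists c : F, [forall x : F, x ^+ 2 != c]].
  by exists c.
rewrite negb_exists => /forallP sq.
have [r rP] : exists r : F -> F, forall c, r c ^+ 2 = c.
  apply: (@fin_all_exists F (fun=> F) (fun c x => x ^+ 2 = c)) => c; have /forallPn[x] := sq c.
  by rewrite negbK => /eqP; exists x.
have sq_inj : injective (fun x : F => x ^+ 2).
  have rK : cancel r (fun x => x ^+ 2) := rP.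
  have bij_r := injF_bij (can_inj rK).
  move=> x y exy; have [s rs sr] := bij_r.
  have E z : s z = z ^+ 2 by rewrite -{2}(sr z) rP.
  by apply: (can_inj sr); rewrite !E.
have /sq_inj/eqP : (1 : F) ^+ 2 = (- 1) ^+ 2 by rewrite sqrrN.
by rewrite -subr_eq0 opprK -(natrD _ 1 1) (negPf two0).
Qed.

Lemma exists_quadratic_extension (F : finFieldType) : odd #|F| ->
  exists (L : finFieldType) (i : {rmorphism F -> L}), #|L| = (#|F| ^ 2)%N.
Proof.
move=> oddF; have [c cP] := exists_nonsquare oddF.
have sp : size ('X^2 - c%:P) = 3%N by rewrite size_XnsubC.
have irr : irreducible_poly ('X^2 - c%:P).
  apply: cubic_irreducible => [|x]; first by rewrite sp.
  by rewrite /root !hornerE subr_eq0 cP.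
have [L dimL _] := irredp_FAdjoin irr.
exists (finvect_type L : finFieldType), (in_alg (finvect_type L)).
have := @card_vspacef F (finvect_type L : finFieldType)
  (Vector.class (finvect_type L : vectType F)).
by rewrite card_vspace => <-; congr (_ ^ _)%N; rewrite dimL sp.
Qed.

(** * Stepanov's method *)

Lemma poly_dependence (L : fieldType) (I : finType) (P : I -> {poly L}) n :
    (forall i, size (P i) <= n)%N -> (n < #|I|)%N ->
  exists2 c : I -> L, exists i, c i != 0 & \sum_i c i *: P i = 0.
Proof.
move=> sP ltn; pose A := \matrix_(k < #|I|) (poly_rV (P (enum_val k)) : 'rV_n).
have /rowV0Pn[u uA u0] : kermx A != 0.
  rewrite -mxrank_eq0 mxrank_ker subn_eq0 -ltnNge.
  exact: leq_ltn_trans (rank_leq_col A) ltn.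
have [k uk] : exists k, u 0 k != 0.
  by have /rV0Pn := u0.
exists (fun i => u 0 (enum_rank i)); first by exists (enum_val k); rewrite enum_valK.
have /sub_kermxP/(congr1 rVpoly) := uA; rewrite mulmx_sum_row linear_sum linear0.
move=> eq0; rewrite -[RHS]eq0 (reindex _ (onW_bij _ (@enum_val_bij I))) /=.
apply: eq_bigr => i _.
by rewrite enum_valK linearZ /= rowK poly_rV_K.
Qed.

Lemma sum_expr_pchar (R : comNzRingType) (I : Type) (r : seq I) (P : pred I)
    (F : I -> R) (n : nat) : [pchar R].-nat n ->
  (\sum_(i <- r | P i) F i) ^+ n = \sum_(i <- r | P i) F i ^+ n.
Proof.
move=> chn; apply: (big_morph (fun x => x ^+ n)).
  by move=> x y; exact: exprDn_pchar.
by rewrite expr0n; case: n chn.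
Qed.

(** Let f = (X^q - X)^2 - c over the field of B^2 elements.  The auxiliary
    polynomial is [aux] = sum over j of (s_j + t_j f^((B+1)/2)) X^(jB), with
    j < (B+1)/2 + q and with s_j, t_j of degree at most (B-1)/2 - q.  At a
    point y with f(y)^((B^2-1)/2) = -1 its B-th power takes the
    value of sum over j of (s_j^B - t_j^B f^((B+1)/2)) X^j, as y^(B^2) = y;
    the coefficients are chosen by linear algebra so that this last polynomial
    is zero, and the auxiliary polynomial then vanishes at all these points.
    The Frobenius power plays the part of the high order of vanishing in the
    usual argument, which would be awkward to express by derivatives in small
    characteristic. *)
Section Stepanov.
Variables (L : finFieldType) (q B : nat) (c : L).
Hypotheses (cardL : #|L| = (B ^ 2)%N) (oddB : odd B) (qB : (2 * q ^ 2 + 2 * q < B)%N).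
Hypotheses (chB : [pchar L].-nat B) (chq : [pchar L].-nat q) (q_gt1 : (1 < q)%N).
Hypothesis c0 : c != 0.

Let w : {poly L} := 'X^q - 'X.
Let f : {poly L} := w ^+ 2 - c%:P.

Let pchar_poly n : [pchar L].-nat n -> [pchar {poly L}].-nat n.
Proof. by apply: sub_in_pnat => p _; rewrite pchar_poly. Qed.

Let size_w : size w = q.+1.
Proof. by rewrite size_polyDl size_polyXn // size_polyN size_polyX. Qed.

Let size_f : size f = (2 * q).+1.
Proof.
have sw2 : size (w ^+ 2) = (2 * q).+1.
  by rewrite expr2 size_mul -?size_poly_eq0 size_w //; lia.
by rewrite size_polyDl ?sw2 // size_polyN size_polyC c0; lia.
Qed.

Let two_neq0 : 2%:R != 0 :> L.
Proof. by rewrite odd_card_two_neq0 // cardL oddX oddB orbT. Qed.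

(** [f] is separable: its derivative is -2 w because [q] vanishes in [L], and
    w^2 - f is a nonzero constant. *)
Let dvd_f_deriv p : p %| f -> p %| f^`() -> size p = 1%N.
Proof.
move=> pf.
have -> : f^`() = (- 2%:R) *: w.
  have chq' : pdiv q \in [pchar {poly L}].
    by apply: pnatPpi (pchar_poly chq) _; rewrite pi_pdiv.
  have q0 : q%:R = 0 :> {poly L}.
    by apply/eqP; rewrite -(dvdn_pcharf chq') pdiv_dvd.
  rewrite /f derivB derivC subr0 deriv_exp expr1 {1}/w derivB derivXn derivX.
  by rewrite -['X^_ *+ q]mulr_natr q0 mulr0 sub0r mulN1r mulNrn scaleNr scaler_nat.
rewrite dvdpZr ?oppr_eq0 // => pw; apply/eqP; rewrite -dvdp1.
have : p %| w ^+ 2 - f by rewrite dvdp_subl // dvdp_exp.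
by rewrite /f subKr -[c%:P]mulr1 mul_polyC dvdpZr.
Qed.

(** The squarefree polynomial [f] is not a constant times the square of a
    rational function. *)
Let no_square (k : L) s t : s ^+ 2 = k *: (f * t ^+ 2) -> k != 0 -> t = 0.
Proof.
move=> st k0; apply/eqP; apply: contraT => t0.
pose g := gcdp s t; have g0 : g != 0 by rewrite gcdp_eq0 negb_and t0 orbT.
pose s1 := s %/ g; pose t1 := t %/ g.
have sE : s = s1 * g by rewrite divpK ?dvdp_gcdl.
have tE : t = t1 * g by rewrite divpK ?dvdp_gcdr.
have cop : coprimep s1 t1 by apply: coprimep_div_gcd; rewrite t0 orbT.
have st1 : s1 ^+ 2 = k *: (f * t1 ^+ 2).
  apply: (mulIf (expf_neq0 2 g0)).
  by rewrite -exprMn -sE st {1}tE -scalerAl -mulrA exprMn.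
have t1c : size t1 = 1%N.
  have cop2 : coprimep t1 (s1 ^+ 2) by rewrite coprimep_expr // coprimep_sym.
  apply/eqP; rewrite -dvdp1 -(Gauss_dvdpr 1 cop2) mulr1.
  by rewrite st1 dvdpZr // expr2 mulrA dvdp_mulIr.
have /size_poly1P[mu mu0 t1E] : size t1 == 1%N by rewrite t1c.
have s1E : s1 ^+ 2 = (k * mu ^+ 2) *: f.
  by rewrite st1 t1E -rmorphXn /= mulrC mul_polyC scalerA.
have km : k * mu ^+ 2 != 0 by rewrite mulf_neq0 ?expf_neq0.
have s1f : s1 %| f by rewrite -(dvdpZr _ _ km) -s1E expr2 dvdp_mulIr.
have s1f' : s1 %| f^`().
  by rewrite -(dvdpZr _ _ km) -derivZ -s1E deriv_exp expr1 -mulrnAl dvdp_mull.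
have : size (s1 ^+ 2) = size f by rewrite s1E size_scale.
have s10 : s1 != 0 by rewrite -size_poly_eq0 (dvd_f_deriv s1f).
rewrite expr2 size_mul // (dvd_f_deriv s1f) // size_f => -[/esym/eqP].
by rewrite muln_eq0 /= eqn0Ngt (ltnW q_gt1).
Qed.

Let h := B./2.
Let BE : B = (2 * h).+1.
Proof. by rewrite -[LHS]odd_double_half oddB mul2n. Qed.
Let J := (h + q).+1.
Let l := (h - q).+1.

Let q_le_h : (q ^ 2 + q <= h)%N.
Proof. by move: qB; rewrite {1}BE ltnS -mulnDr leq_mul2l. Qed.

Let poly_root_bound (p : {poly L}) (A : {set L}) : p != 0 ->
  {in A, forall y, p.[y] = 0} -> (#|A| < size p)%N.
Proof.
move=> p0 pA; rewrite cardE; apply: max_poly_roots; rewrite ?enum_uniq //.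
by apply/allP => y; rewrite mem_enum => /pA; rewrite /root => ->.
Qed.

Let frob_frob (x : L) : x ^+ (B * B) = x.
Proof. by rewrite mulnn -cardL expf_card. Qed.

Let half_euler : ((B ^ 2 - 1)./2 + h.+1 = B * h.+1)%N.
Proof.
have -> : (B ^ 2 - 1)./2 = (2 * (h * h.+1))%N.
  rewrite -[RHS]doubleK -!mul2n; congr (_./2); rewrite BE; clear; lia.
rewrite BE; clear; lia.
Qed.

Let coef_vanish (a : 'I_l -> L) i : \sum_(i < l) (a i ^+ B) *: 'X^i = 0 -> a i = 0.
Proof.
move/(congr1 (fun p : {poly L} => p`_i)); rewrite coef0 coef_sum (bigD1 i) //=.
rewrite coefZ coefXn eqxx mulr1 big1 => [|j ne]; last first.
  by rewrite coefZ coefXn eq_sym val_eqE (negPf ne) mulr0.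
by rewrite addr0 => /eqP; rewrite expf_eq0 => /andP[_ /eqP].
Qed.

(** Modulo X^B, f^B is its constant term k, hence s^2 - k f t^2 is divisible by
    X^B; its degree is less than [B], so it is zero, and [no_square]
    applies. *)
Let block_vanish (s t : {poly L}) : (size s <= l)%N -> (size t <= l)%N ->
  'X^B %| s + t * f ^+ h.+1 -> s = 0 /\ t = 0.
Proof.
move=> ss st dvd; pose k := (- c) ^+ B.
have k0 : k != 0 by rewrite expf_neq0 // oppr_eq0.
have fB : 'X^B %| f ^+ B - k%:P.
  have -> : k%:P = (- c%:P) ^+ B :> {poly L} by rewrite -polyCN -rmorphXn.
  rewrite -exprNn_pchar ?pchar_poly // -exprDn_pchar ?pchar_poly //.
  rewrite dvdp_exp2r // /f opprK subrK dvdp_exp // /w.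
  by apply: dvdp_sub => //; rewrite dvdp_exp // (ltnW q_gt1).
have dvd2 : 'X^B %| s ^+ 2 - k *: (f * t ^+ 2).
  have -> : s ^+ 2 - k *: (f * t ^+ 2) =
      (s + t * f ^+ h.+1) * (s - t * f ^+ h.+1) + (f ^+ B - k%:P) * (f * t ^+ 2).
    have fF : f ^+ B * f = f ^+ h.+1 * f ^+ h.+1.
      by rewrite -exprSr -exprD; congr (_ ^+ _); move: BE; clear; lia.
    rewrite (mulrBl (f * t ^+ 2) (f ^+ B)) (mulrA (f ^+ B)) fF -mul_polyC.
    by move: (f ^+ h.+1) => F; ring.
  by apply: dvdp_add; rewrite dvdp_mulr.
have eq2 : s ^+ 2 = k *: (f * t ^+ 2).
  apply/eqP; rewrite -subr_eq0; apply: contraLR dvd2 => /dvdp_leq dvd_le.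
  apply/negP => /dvd_le; rewrite size_polyXn ltnNge (leq_trans (size_polyD _ _)) //.
  rewrite size_polyN size_scale // geq_max !expr2.
  have := size_polyMleq s s; have := size_polyMleq f (t * t).
  have := size_polyMleq t t; rewrite size_f.
  move: ss st (leq_trans (leq_addl _ _) q_le_h) BE; rewrite /l.
  move: (size s) (size t) (size (s * s)) (size (t * t)) (size (f * (t * t))) h.
  by clear => *; apply/andP; split; lia.
have t0 := no_square eq2 k0; split=> //.
by apply/eqP; move/eqP: eq2; rewrite t0 expr0n mulr0 scaler0 expf_eq0.
Qed.

Let index : finType := ('I_J * 'I_l * bool)%type.

(** The unknowns outnumber the coefficients to be cancelled exactly because
    2 q^2 + 2 q < B. *)
Let dependence : exists2 a : index -> L, exists x, a x != 0 &
  \sum_x a x *: ('X^(B * x.1.2 + x.1.1)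
    * (if x.2 then - f ^+ h.+1 else 1 : {poly L})) = 0.
Proof.
apply: (@poly_dependence _ _ _ (B * (h - q) + (h + q) + 2 * q * h.+1).+1).
  move=> [[j i] b] /=; apply: leq_trans (size_polyMleq _ _) _.
  rewrite size_polyXn.
  have sf : (size (if b then - f ^+ h.+1 else 1 : {poly L})%R <= (2 * q * h.+1).+1)%N.
    case: b; rewrite ?size_polyN ?size_poly1 //.
    by apply: leq_trans (size_poly_exp_leq _ _) _; rewrite size_f.
  have := ltn_ord j; have := ltn_ord i; rewrite !ltnS => lei lej.
  have := leq_mul (leqnn B) lei; move: sf lej.
  move: (size _) (nat_of_ord j) (B * i)%N (B * (h - q))%N (2 * q * h.+1)%N (h + q)%N.
  by clear => *; lia.
rewrite !card_prod !card_ord card_bool /J /l BE.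
move: q_le_h; clear; nia.
Qed.

(** The number of points is at most the degree of the auxiliary polynomial. *)
Lemma stepanov :
  (2 * #|[set y | (f.[y] ^+ (B ^ 2 - 1)./2 == -1)%R]| <= B ^ 2 + 4 * q * B)%N.
Proof.
have [a [x0 ax0] rel] := dependence.
pose u (b : bool) : {poly L} := if b then f ^+ h.+1 else 1.
pose aux := \sum_(x : index) a x ^+ B *: ('X^(x.1.2 + x.1.1 * B) * u x.2).
have aux_root : {in [set y | (f.[y] ^+ (B ^ 2 - 1)./2 == -1)%R], forall y, aux.[y] = 0}.
  move=> y; rewrite inE => /eqP fy; apply/eqP.
  have: aux.[y] ^+ B == 0; last by rewrite expf_eq0 => /andP[].
  have /(congr1 (horner^~ y)) := rel; rewrite horner0 => <-; apply/eqP.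
  rewrite !horner_sum sum_expr_pchar //; apply: eq_bigr => x _.
  rewrite !hornerZ !hornerM !hornerXn !exprMn -exprM frob_frob; congr (_ * (_ * _)).
    rewrite -exprM mulnDl -mulnA !exprD [in X in _ * X]mulnC [X in _ * X]exprM.
    by rewrite frob_frob mulnC.
  rewrite /u; case: x.2; last by rewrite hornerC expr1n.
  by rewrite hornerN horner_exp -exprM mulnC -half_euler exprD fy mulN1r.
have size_aux : (size aux <= (h - q + (h + q) * B + 2 * q * h.+1).+1)%N.
  apply: leq_trans (size_sum _ _ _) _; apply/bigmax_leqP => -[[j i] b] _ /=.
  apply: leq_trans (size_scale_leq _ _) _.
  apply: leq_trans (size_polyMleq _ _) _; rewrite size_polyXn.
  have sf : (size (u b) <= (2 * q * h.+1).+1)%N.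
    rewrite /u; case: b; rewrite ?size_poly1 //.
    by apply: leq_trans (size_poly_exp_leq _ _) _; rewrite size_f.
  have := ltn_ord j; have := ltn_ord i; rewrite !ltnS => lei lej.
  have := leq_mul lej (leqnn B); move: sf lei.
  move: (size _) (nat_of_ord i) (j * B)%N ((h + q) * B)%N (2 * q * h.+1)%N (h - q)%N.
  by clear => *; lia.
(* The blocks are killed one after the other: once those of index below n
   vanish, X^(nB) times block n is congruent to aux = 0 modulo X^((n+1)B). *)
have aux_neq0 : aux != 0.
  apply: contra_neqN ax0 => /eqP aux0.
  suff all0 n (x : index) : (x.1.1 < n)%N -> a x = 0 by exact: all0 _ _ (ltn_ord _).
  elim: n x => // n IH x; rewrite ltnS leq_eqVlt => /predU1P[xn|]; last exact: IH.
  pose s b := \sum_(i < l) a (x.1.1, i, b) ^+ B *: 'X^i : {poly L}.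
  have ss b : (size (s b) <= l)%N.
    apply: leq_trans (size_sum _ _ _) _; apply/bigmax_leqP => i _.
    apply: leq_trans (size_scale_leq _ _) _.
    by rewrite size_polyXn.
  have [] := block_vanish (ss false) (ss true).
    rewrite -(dvdp_mul2l _ _ (_ : 'X^(n * B) != 0)) ?monic_neq0 ?monicXn //.
    rewrite -exprD -mulSnr.
    have -> : 'X^(n * B) * (s false + s true * f ^+ h.+1) =
        aux - \sum_(y : index | y.1.1 != x.1.1)
                 a y ^+ B *: ('X^(y.1.2 + y.1.1 * B) * u y.2).
      rewrite /aux [X in _ = X - _](bigID (fun y : index => y.1.1 == x.1.1)) /= addrK.
      rewrite (reindex_onto (fun p : 'I_l * bool => (x.1.1, p.1, p.2))
                            (fun y => (y.1.2, y.2))) /=; last first.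
        by move=> [[j i] b] /= /eqP->.
      rewrite (eq_bigl xpredT) => [|[i b]]; last by rewrite /= !eqxx.
      rewrite -(pair_bigA _ (fun i b =>
        a (x.1.1, i, b) ^+ B *: ('X^(i + x.1.1 * B) * u b))) /=.
      rewrite /s mulrDr !mulr_suml !mulr_sumr -big_split /=; apply: eq_bigr => i _.
      rewrite big_bool /= xn /u mulr1 exprD addrC; congr (_ + _).
        by rewrite -!scalerAl -!scalerAr mulrA [_ * 'X^i]mulrC.
      by rewrite -scalerAr mulrC.
    rewrite aux0 sub0r dvdpNr.
    apply: (big_ind (fun p => _ %| p)) => [|p1 p2|y yx]; [exact: dvdp0|exact: dvdp_add|].
    have [yn|yn] := ltnP y.1.1 n.
      by rewrite IH // expr0n; case: (B) oddB => //= *; rewrite scale0r dvdp0.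
    have lt_ny : (n < y.1.1)%N by rewrite ltn_neqAle yn andbT -xn eq_sym.
    rewrite -mul_polyC; apply: dvdp_mull; apply: dvdp_mulr.
    rewrite dvdp_exp2l //; apply: leq_trans (leq_addl _ _).
    by rewrite leq_mul2r lt_ny orbT.
  case: x xn @s ss => -[j i] [] /= _ _ s0 s1; first exact: coef_vanish s1.
  exact: coef_vanish s0.
have := leq_trans (poly_root_bound aux_neq0 aux_root) size_aux; rewrite ltnS.
move: #|_| (leq_trans (leq_addl _ _) q_le_h) BE; move: h; clear => *.
nia.
Qed.

End Stepanov.

(** * Additive characters *)

Section FieldExtension.
Variables (F L : finFieldType) (i : {rmorphism F -> L}).

Lemma pchar_rmorph n : [pchar F].-nat n -> [pchar L].-nat n.
Proof. by apply: sub_in_pnat => p _; apply: rmorph_pchar. Qed.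

Lemma rmorph_card_fixed (x : F) : i x ^+ #|F| = i x.
Proof. by rewrite -rmorphXn expf_card. Qed.

Lemma card_fixed_rmorph z : z ^+ #|F| = z -> exists x, i x = z.
Proof.
move=> zF; have [/existsP[x /eqP]|] := boolP [exists x, i x == z]; first by exists x.
rewrite negb_exists => /forallP notin; exfalso.
pose p : {poly L} := 'X^#|F| - 'X.
have sp : size p = #|F|.+1.
  by rewrite size_polyDl size_polyXn // size_polyN size_polyX ltnS finNzRing_gt1.
have := @max_poly_roots _ p (z :: codom i).
rewrite -size_poly_eq0 sp /= size_codom ltnn => bad; suff: false by []; apply: bad => //=.
  rewrite /root !hornerE zF subrr eqxx /=; apply/allP => _ /codomP[x ->].
  by rewrite /root !hornerE rmorph_card_fixed subrr.
rewrite map_inj_uniq ?enum_uniq ?andbT; last exact: fmorph_inj.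
by apply/codomP => -[x zx]; have := notin x; rewrite zx eqxx.
Qed.

End FieldExtension.

Definition additive_char (F : finFieldType) (chi : F -> algC) :=
  [/\ {morph chi : x y / x + y >-> x * y}, chi 0 = 1 & exists x, chi x != 1].

Section AdditiveChar.
Variables (F : finFieldType) (chi : F -> algC) (chiP : additive_char chi).

Lemma additive_charN x : chi (- x) = (chi x)^-1.
Proof.
have [chiD chi0 _] := chiP; have inv_x : chi x * chi (- x) = 1 by rewrite -chiD subrr.
have chi_x0 : chi x != 0.
  by apply: contra_eq_neq inv_x => ->; rewrite mul0r eq_sym oner_eq0.
by apply: (mulfI chi_x0); rewrite inv_x divff.
Qed.

Lemma additive_char_norm x : `|chi x| = 1.
Proof.
have [chiD chi0 _] := chiP; have [p pp chp] := finPcharP F.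
have chiMn n : chi (x *+ n) = chi x ^+ n.
  by elim: n => [|n IH]; rewrite ?mulr0n ?chi0 // mulrS exprS chiD IH.
have : `|chi x| ^+ p = 1.
  by rewrite -normrX -chiMn -mulr_natr (pcharf0 chp) mulr0 chi0 normr1.
by move/eqP; rewrite pexpr_eq1 ?prime_gt0 // => /eqP.
Qed.

Lemma additive_char_conj x : (chi x)^* = chi (- x).
Proof.
rewrite additive_charN; have chi_x := additive_char_norm x.
have chi0 : chi x != 0 by rewrite -normr_eq0 chi_x oner_eq0.
by apply: (mulfI chi0); rewrite -normCK chi_x expr1n divff.
Qed.

Lemma additive_char_sum c :
  \sum_x chi (c * x) = if c == 0 then #|F|%:R else 0.
Proof.
have [chiD chi0 [y chiy]] := chiP; case: eqVneq => [->|c0].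
  rewrite (eq_bigr (fun=> 1)) => [|x _]; last by rewrite mul0r chi0.
  by rewrite big_const iter_addr_0 cardE.
set S := \sum_x _; have : S = chi y * S.
  rewrite {1}/S (reindex_inj (addrI (y / c))) mulr_sumr /=.
  by apply: eq_bigr => x _; rewrite -chiD mulrDr mulrC divfK.
move/eqP; rewrite -subr_eq0 -{1}[S]mul1r -mulrBl mulf_eq0 subr_eq0 eq_sym.
by rewrite (negPf chiy) => /eqP.
Qed.

End AdditiveChar.

(** * Kloosterman sums in a quadratic extension *)

Definition kloosterman (F : finFieldType) (chi : F -> algC) a b :=
  \sum_(x : F | x != 0) chi (a * x + b / x).

Lemma sum_nat_saturated (I : finType) (n : I -> nat) k :
  (forall i, n i <= k)%N -> (\sum_i n i = k * #|I|)%N -> forall i, n i = k.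
Proof.
move=> le_n sum_n i; apply/eqP; rewrite eqn_leq le_n /=.
have : (\sum_i (k - n i) == 0)%N.
  rewrite -(eqn_add2r (\sum_i n i)) add0n -big_split /= sum_n.
  by rewrite (eq_bigr (fun=> k)) => [|j _]; rewrite ?sum_nat_const ?subnK // mulnC.
by rewrite sum_nat_eq0 => /forallP/(_ i); rewrite subn_eq0.
Qed.

Lemma sum_by_fiber (I J : finType) (P : pred J) (h : I -> J) (g : J -> algC) :
  \sum_(i | P (h i)) g (h i) = \sum_(j | P j) g j *+ #|[set i | h i == j]|.
Proof.
rewrite (partition_big h P) //=; apply: eq_bigr => j Pj.
rewrite (eq_bigr (fun=> g j)) => [|i /andP[_ /eqP->] //].
rewrite big_const iter_addr_0; congr (_ *+ _); apply: eq_card => i.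
by rewrite !inE unfold_in; case: eqP => [->|]; rewrite ?Pj ?andbF.
Qed.

Lemma sum_card_fiber (I J : finType) (h : I -> J) :
  (\sum_j #|[set i | h i == j]| = #|I|)%N.
Proof.
rewrite -[RHS]sum1_card (partition_big h xpredT) //=.
by apply: eq_bigr => j _; rewrite sum1_card; apply: eq_card => i; rewrite inE.
Qed.

Section QuadraticDoubling.
Variables (F L : finFieldType) (i : {rmorphism F -> L}).
Hypotheses (oddF : odd #|F|) (cardL : #|L| = (#|F| ^ 2)%N).
Let q := #|F|.

Let frobD (x y : L) : (x + y) ^+ q = x ^+ q + y ^+ q.
Proof. by rewrite exprDn_pchar // (pchar_rmorph i) // pchar_nat_card. Qed.

Let frob2 (z : L) : z ^+ q ^+ q = z.
Proof. by rewrite -exprM mulnn -cardL expf_card. Qed.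

Lemma exists_trace_norm : exists2 tr : L -> F, forall z, i (tr z) = z + z ^+ q
  & exists nm : L -> F, forall z, i (nm z) = z * z ^+ q.
Proof.
have [tr trP] : exists tr : L -> F, forall z, i (tr z) = z + z ^+ q.
  apply: (@fin_all_exists L (fun=> F) (fun z x => i x = z + z ^+ q)) => z.
  by apply: card_fixed_rmorph; rewrite frobD frob2 addrC.
exists tr => //.
apply: (@fin_all_exists L (fun=> F) (fun z x => i x = z * z ^+ q)) => z.
by apply: card_fixed_rmorph; rewrite exprMn frob2 mulrC.
Qed.

Variables (tr nm : L -> F).
Hypotheses (trP : forall z, i (tr z) = z + z ^+ q) (nmP : forall z, i (nm z) = z * z ^+ q).

Let i_inj : injective i := fmorph_inj i.

Lemma traceD x y : tr (x + y) = tr x + tr y.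
Proof. by apply: i_inj; rewrite rmorphD !trP frobD; ring. Qed.

Lemma traceZ c z : tr (i c * z) = c * tr z.
Proof. by apply: i_inj; rewrite rmorphM !trP exprMn rmorph_card_fixed; ring. Qed.

Lemma trace_exp z m : [pchar F].-nat m -> tr (z ^+ m) = tr z ^+ m.
Proof.
move=> chm; apply: i_inj; rewrite rmorphXn !trP exprDn_pchar ?(pchar_rmorph i) //.
by rewrite exprAC.
Qed.

Lemma trace_half x : tr (i (x / 2%:R)) = x.
Proof.
apply: i_inj; rewrite trP rmorph_card_fixed -rmorphD; congr (i _).
by rewrite -[LHS]mulr2n -[LHS]mulr_natr divfK // odd_card_two_neq0.
Qed.

Let fiberF (p : F * F) := [set x : F * F | (x.1 + x.2, x.1 * x.2) == p].
Let fiberL (p : F * F) := [set z : L | (tr z, nm z) == p].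

(** Both the pairs of elements of [F] with sum [s] and product [t] and the
    elements of [L] with trace [s] and norm [t] are roots of X^2 - sX + t.  A
    root common to the two families is in [F] and equals its own conjugate, so
    it is a double root. *)
Let fiber_le2 p : (#|fiberF p| + #|fiberL p| <= 2)%N.
Proof.
case: p => s t; pose A := [set x | x * (s - x) == t].
have -> : #|fiberF (s, t)| = #|A|.
  rewrite -(card_imset (mem A) (_ : injective (fun x => (x, s - x)))); last by move=> x y [].
  apply: eq_card => -[x y]; rewrite inE /=; apply/eqP/imsetP => [[sE tE]|[z + [-> ->]]].
    by exists x; rewrite ?inE -sE addrAC subrr add0r ?tE.
  by rewrite inE => /eqP <-; rewrite addrC subrK.
have inL z : z \in fiberL (s, t) -> z * (i s - z) = i t.
  by rewrite inE => /eqP[<- <-]; rewrite trP nmP addrAC subrr add0r.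
have inA x : x \in A -> i x * (i s - i x) = i t.
  by rewrite inE => /eqP <-; rewrite rmorphM rmorphB.
pose roots z := z * (i s - z) = i t.
have [/existsP[x /andP[xA xL]]|] := boolP [exists x, (x \in A) && (i x \in fiberL (s, t))].
  have sx : i s = i x + i x.
    by move: xL; rewrite inE => /eqP[<- _]; rewrite trP rmorph_card_fixed.
  have uniq_root z : roots z -> z = i x.
    move=> rz; apply/eqP; rewrite -subr_eq0 -sqrf_eq0; apply/eqP.
    have e : roots z = (z * (i s - z) = i x * (i s - i x)) by rewrite (inA x xA).
    by move: rz; rewrite e sx => /eqP; rewrite -subr_eq0 -oppr_eq0 => /eqP <-; ring.
  have cA : (#|A| <= #|[set x]|)%N.
    by apply: subset_leq_card; apply/subsetP => y /inA/uniq_root/i_inj->; rewrite inE.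
  have cL : (#|fiberL (s, t)| <= #|[set i x]|)%N.
    by apply: subset_leq_card; apply/subsetP => y /inL/uniq_root->; rewrite inE.
  by move: cA cL; rewrite !cards1; lia.
rewrite negb_exists => /forallP disj.
have sub : {in i @: A :|: fiberL (s, t), forall z, roots z}.
  by move=> z; rewrite !inE => /orP[/imsetP[x xA ->]|zL]; [exact: inA|apply: inL; rewrite inE].
have -> : (#|A| + #|fiberL (s, t)|)%N = #|i @: A :|: fiberL (s, t)|.
  rewrite cardsU disjoint_setI0 ?cards0 ?subn0 ?card_imset //.
  apply/pred0P => z /=; apply/negbTE; apply/negP => /andP[/imsetP[x xA ->] xL].
  by have := disj x; rewrite xA xL.
have [->|[z0 z0S]] := set_0Vmem (i @: A :|: fiberL (s, t)); first by rewrite cards0.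
apply: leq_trans (subset_leq_card (_ : _ \subset [set z0; i s - z0])) _; last first.
  by rewrite cards2; case: eqP.
apply/subsetP => z /sub rz; rewrite !inE -!(subr_eq0 z) -mulf_eq0.
move: (sub _ z0S) rz; rewrite /roots => <- /eqP; rewrite -subr_eq0 -oppr_eq0 => /eqP <-.
by apply/eqP; ring.
Qed.

(** Summed over all (s, t), both families have q^2 members, so the bound by 2 is
    attained everywhere: a polynomial that does not split over [F] splits over
    [L]. *)
Let fiber_eq2 p : (#|fiberF p| + #|fiberL p|)%N = 2%N.
Proof.
apply: (sum_nat_saturated fiber_le2) p; rewrite big_split /=.
by rewrite !sum_card_fiber card_prod cardL mul2n addnn mulnn.
Qed.

(** Both K^2 and the sum over [L] are sums of chi (a s + b s / t) over sums and
    products, respectively traces and norms, (s, t).  By [fiber_eq2] they add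
    up to twice the sum over all s and all t <> 0, and the sum over s leaves
    only t = - b / a. *)
Lemma kloosterman_doubling (chi : F -> algC) a b : additive_char chi ->
    a != 0 -> b != 0 ->
  kloosterman (chi \o tr) (i a) (i b) = 2%:R * q%:R - kloosterman chi a b ^+ 2.
Proof.
move=> chiP a0 b0; have [chiD chi0 _] := chiP.
pose g (p : F * F) := chi (a * p.1 + b * p.1 / p.2).
have sumF : kloosterman chi a b ^+ 2 =
    \sum_(p : F * F | p.2 != 0) g p *+ #|fiberF p|.
  rewrite -(sum_by_fiber (fun p : F * F => p.2 != 0) (fun x => (x.1 + x.2, x.1 * x.2)) g) /=.
  rewrite expr2 /kloosterman mulr_suml (eq_bigr _ (fun x _ => mulr_sumr _ _ _ _)).
  rewrite pair_big /=; apply: eq_big => [[x y]|[x y] /= /andP[x0 y0]].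
    by rewrite mulf_eq0 negb_or.
  rewrite -chiD /g /=; congr chi; field; by rewrite ?x0 ?y0.
have sumL : kloosterman (chi \o tr) (i a) (i b) =
    \sum_(p : F * F | p.2 != 0) g p *+ #|fiberL p|.
  rewrite -(sum_by_fiber (fun p : F * F => p.2 != 0) (fun z => (tr z, nm z)) g) /=.
  have nm0 z : (nm z != 0) = (z != 0).
    by rewrite -(fmorph_eq0 i) nmP -exprS expf_eq0.
  apply: eq_big => [z|z z0]; first by rewrite nm0.
  rewrite /g /=; congr chi; apply: i_inj.
  rewrite trP !rmorphD !rmorphM fmorphV trP nmP frobD !exprMn exprVn !rmorph_card_fixed.
  by field; rewrite ?z0 ?expf_neq0.
apply/eqP; rewrite eq_sym subr_eq eq_sym sumF sumL -big_split /=; apply/eqP.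
rewrite (eq_bigr (fun p => g p *+ 2)) => [|p _]; last first.
  by rewrite -mulrnDr addnC fiber_eq2.
rewrite sumrMnl mulrC mulr_natr; congr (_ *+ _).
transitivity (\sum_(t : F | t != 0) \sum_s chi ((a + b / t) * s)).
  rewrite exchange_big pair_big /=; apply: eq_bigr => -[s t] /= _.
  by rewrite /g /=; congr chi; ring.
rewrite (eq_bigr _ (fun t _ => additive_char_sum chiP _)).
have ba0 : - b / a != 0 by rewrite mulf_neq0 ?oppr_eq0 ?invr_eq0.
rewrite (bigD1 (- b / a)) //= big1 => [|t /andP[t0 ne]].
  by rewrite addr0 mulNr invrN invf_div mulrN mulrC divfK // subrr eqxx.
case: eqP => // /eqP; rewrite addr_eq0 => /eqP e; case/eqP: ne.
by rewrite e; field; rewrite t0 oppr_eq0.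
Qed.

End QuadraticDoubling.

(** * The tower of quadratic extensions *)

(** With [Q] = #|F| and [k] a Kloosterman sum of F, the Kloosterman sum of the
    extension of degree 2^j. *)
Fixpoint doubling (R : pzRingType) (Q k : R) (j : nat) : R :=
  if j is j'.+1 then 2%:R * Q ^+ (2 ^ j') - doubling Q k j' ^+ 2 else k.

Lemma rmorph_doubling (R S : pzRingType) (h : {rmorphism R -> S}) Q k j :
  h (doubling Q k j) = doubling (h Q) (h k) j.
Proof. by elim: j => //= j IH; rewrite rmorphB rmorphM rmorph_nat !rmorphXn IH. Qed.

(** If k_j^2 = (4 + e) Q_j with e > 0 and Q_j = Q^(2^j), then
    k_(j+1) = - (2 + e) Q_j, whose square is (4 + 4 e + e^2) Q_(j+1): the excess
    over 4 is at least multiplied by 4 at each level. *)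
Lemma doubling_unbounded (R : archiRealFieldType) (Q k : R) :
    0 < Q -> 4 * Q < k ^+ 2 ->
  forall M, exists J0, forall J, (J0 <= J)%N ->
    M * Q ^+ (2 ^ J) < doubling Q k J ^+ 2.
Proof.
move=> Q0 k0; pose v := k ^+ 2 / Q - 4.
have v0 : 0 < v by rewrite /v subr_gt0 ltr_pdivlMr.
have grow J : (4 + 4 ^+ J * v) * Q ^+ (2 ^ J) <= doubling Q k J ^+ 2.
  elim: J => [|J IH].
    by rewrite expn0 !expr1 expr0 mul1r /v addrC subrK divfK // gt_eqF.
  rewrite expnS mulnC exprM /= exprS.
  have : 0 < Q ^+ (2 ^ J) by rewrite exprn_gt0.
  have : 0 < (4 : R) ^+ J * v by rewrite mulr_gt0 ?exprn_gt0.
  move: IH; move: (doubling Q k J ^+ 2) (Q ^+ (2 ^ J)) => K P.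
  rewrite -mulrA; move: (_ * v) => e le_K e0 P0.
  have : 0 <= (K - 2 * P - (2 + e) * P) * (K - 2 * P + (2 + e) * P).
    by apply: mulr_ge0; nra.
  have : 0 < e * e * P * P by rewrite !mulr_gt0.
  by nra.
move=> M; exists (Num.bound `|M / v|) => J leJ.
apply: lt_le_trans (grow J); rewrite ltr_pM2r ?exprn_gt0 //.
have lt4 : (J%:R : R) < 4 ^+ J by rewrite -natrX ltr_nat ltn_expl.
have : M / v < J%:R.
  apply: le_lt_trans (ler_norm _) _.
  by apply: lt_le_trans (archi_boundP (normr_ge0 _)) _; rewrite ler_nat.
rewrite ltr_pdivrMr // => MJ; have : J%:R * v < 4 ^+ J * v by rewrite ltr_pM2r.
by move: MJ; move: (_ * v) (_ * v) => x y; lra.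
Qed.

(** [T] is the trace from [L] to [F]; it kills y^q - y by the easy half of
    Hilbert's Theorem 90. *)
Lemma exists_tower (F : finFieldType) J : odd #|F| ->
  exists (L : finFieldType) (i : {rmorphism F -> L}) (T : L -> F),
  [/\ #|L| = (#|F| ^ (2 ^ J))%N, {morph T : x y / x + y},
      forall c z, T (i c * z) = c * T z,
      (forall y, T (y ^+ #|F| - y) = 0) /\ (exists z, T z != 0)
    & forall (chi : F -> algC) a b, additive_char chi -> a != 0 -> b != 0 ->
      kloosterman (chi \o T) (i a) (i b)
        = doubling #|F|%:R (kloosterman chi a b) J].
Proof.
move=> oddF; elim: J => [|J [L [i [T [cardL TD TZ [Tfrob [z0 Tz0]] klT]]]]].
  exists F, idfun, id; rewrite expn0 expn1; split=> //.
  by split=> [y|]; [rewrite expf_card subrr | exists 1; rewrite oner_eq0].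
have oddL : odd #|L| by rewrite cardL oddX oddF orbT.
have [L' [i' cardL']] := exists_quadratic_extension oddL.
have [tr trP [nm nmP]] := exists_trace_norm i' cardL'.
have chF : [pchar L].-nat #|F| by rewrite (pchar_rmorph i) // pchar_nat_card.
have trD := traceD trP.
have trN y : tr (- y) = - tr y.
  have tr0 : tr 0 = 0 by apply: (addrI (tr 0)); rewrite -trD !addr0.
  by apply/eqP; rewrite -addr_eq0 -trD addNr tr0.
exists L', (i' \o i), (T \o tr); split => /=.
- by rewrite cardL' cardL -expnM expnS mulnC.
- by move=> x y /=; rewrite trD TD.
- by move=> c z; rewrite (traceZ trP) TZ.
- split=> [y|]; first by rewrite trD trN (trace_exp trP) // Tfrob.
  by exists (i' (z0 / 2%:R)); rewrite (trace_half oddL trP).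
move=> chi a b chiP a0 b0.
have chiT : additive_char (chi \o T).
  have [chiD chi0 [c chic]] := chiP; split=> [x y||] /=.
  - by rewrite /= TD chiD.
  - by rewrite /= -[0](mulr0 (i 0)) TZ mul0r.
  - by exists (i (c / T z0) * z0); rewrite /= TZ divfK.
have := kloosterman_doubling oddL cardL' trP nmP chiT (_ : i a != 0) (_ : i b != 0).
rewrite !fmorph_eq0 => /(_ a0 b0) /= ->.
by rewrite klT // cardL natrX.
Qed.

(** * Counting points on y^q - y = a x + b / x *)

Lemma euler_criterion (L : finFieldType) (z : L) : odd #|L| -> z != 0 ->
  z ^+ (#|L| - 1)./2 = -1 \/ exists d, d ^+ 2 = z.
Proof.
move=> oddL z0; set m := (_./2); have L1 := finNzRing_gt1 L.
have mE : (2 * m = #|L| - 1)%N.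
  rewrite mul2n /m subn1 -[in RHS](odd_double_half #|L|) oddL.
  by case: #|L| oddL => //= n; rewrite uphalf_half => /negPf->.
have unitL x : x != 0 -> x ^+ (2 * m) = 1 :> L.
  move=> x0; apply: (mulfI x0); rewrite mulr1 -exprS mE subn1 prednK ?expf_card //.
  exact: ltnW.
have := unitL z z0; rewrite mulnC exprM => /eqP; rewrite sqrf_eq1.
case/orP => /eqP zm; last by left.
have m0 : (0 < 2 * m)%N by rewrite mE subn_gt0.
have /hasP[g _ gP] : has (2 * m).-primitive_root (enum [pred x : L | x != 0]).
  apply: has_prim_root => //; rewrite ?enum_uniq //.
    by apply/allP => x; rewrite mem_enum inE unity_rootE => /unitL->.
  by rewrite -cardE -(eq_card (fun x => _ : x \in predC1 0 = _)) // cardC1 mE subn1.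
have [[j _] /= zj] := prim_rootP gP (unitL z z0).
right; exists (g ^+ (j./2)); rewrite -exprM mulnC mul2n zj; congr (_ ^+ _).
rewrite -[RHS]odd_double_half (_ : odd j = false) //; apply/negbTE; rewrite -dvdn2.
have m0' : (0 < m)%N by rewrite lt0n; apply: contraTneq m0 => ->.
rewrite -(dvdn_pmul2r m0') (prim_order_dvd gP).
by rewrite exprM -zj zm.
Qed.

(** For fixed y the equation is quadratic in x, with discriminant f(y).  Hence
    it has two solutions unless f(y) is zero or a nonsquare, and [stepanov]
    says that about half of the y at most are of the second kind. *)
Section PointCount.
Variables (F L : finFieldType) (i : {rmorphism F -> L}) (T : L -> F) (B : nat).
Hypotheses (cardL : #|L| = (B ^ 2)%N) (chB : [pchar L].-nat B) (oddB : odd B).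
Let q := #|F|.
Hypothesis qB : (2 * q ^ 2 + 2 * q < B)%N.
Hypothesis Tfrob : forall y, T (y ^+ q - y) = 0.
Variables (a b : L) (a0 : a != 0) (b0 : b != 0).

Let g x := a * x + b / x.
Let w y := y ^+ q - y : L.
Let f y := w y ^+ 2 - 4%:R * a * b.

Let two0 : 2%:R != 0 :> L.
Proof. by rewrite odd_card_two_neq0 // cardL oddX oddB orbT. Qed.

Let four0 : 4%:R != 0 :> L.
Proof. by rewrite (natrM _ 2 2) mulf_neq0. Qed.

Let q_gt1 : (1 < q)%N.
Proof. exact: finNzRing_gt1. Qed.

Let c0 : 4%:R * a * b != 0.
Proof. by rewrite !mulf_neq0. Qed.

Let card_fiber_w z : (#|[set y | w y == z]| <= q)%N.
Proof.
pose p : {poly L} := 'X^q - 'X - z%:P.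
have sp : size p = q.+1.
  rewrite /p -addrA size_polyDl size_polyXn // -opprD size_polyN.
  by rewrite size_polyDl size_polyX // size_polyC; case: (z != 0).
rewrite cardE -ltnS -sp; apply: max_poly_roots; rewrite ?enum_uniq //.
  by rewrite -size_poly_eq0 sp.
by apply/allP => y; rewrite mem_enum inE /root !hornerE subr_eq0.
Qed.

Let card_zeros_f : (#|[set y | f y == 0%R]| <= 2 * q)%N.
Proof.
have [->|[y0]] := set_0Vmem [set y | f y == 0%R]; first by rewrite cards0.
rewrite inE => /eqP fy0.
have sub : [set y | f y == 0%R] \subset [set y | w y == w y0] :|: [set y | w y == - w y0].
  apply/subsetP => y; rewrite !inE => /eqP fy; rewrite -eqf_sqr.
  have wE z : w z ^+ 2 = f z + 4%:R * a * b by rewrite /f subrK.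
  by rewrite !wE fy fy0.
apply: leq_trans (subset_leq_card sub) _; apply: leq_trans (leq_card_setU _ _) _.
by rewrite mul2n -addnn leq_add // card_fiber_w.
Qed.

Let card_nonsquares :
  (2 * #|[set y | (f y ^+ (B ^ 2 - 1)./2 == -1)%R]| <= B ^ 2 + 4 * q * B)%N.
Proof.
have chq : [pchar L].-nat q by rewrite (pchar_rmorph i) // pchar_nat_card.
have := stepanov cardL oddB qB chB chq q_gt1 c0.
congr (_ * _ <= _)%N; apply: eq_card => y; rewrite !inE; congr (_ ^+ _ == _).
by rewrite !hornerE.
Qed.

Let fiber_square y : (exists d, d ^+ 2 = f y) -> f y != 0 ->
  (2 <= #|[set x | (x != 0%R) && (g x == w y)]|)%N.
Proof.
case=> d df f0; have d0 : d != 0 by rewrite -sqrf_eq0 df.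
pose x1 := (w y + d) / (2%:R * a); pose x2 := (w y - d) / (2%:R * a).
have prod : x1 * x2 = b / a.
  have -> : x1 * x2 = (w y ^+ 2 - d ^+ 2) / (4%:R * a ^+ 2).
    by rewrite /x1 /x2; field; rewrite ?a0 ?two0 ?four0.
  by rewrite df /f; field; rewrite ?a0 ?two0 ?four0.
have sum : a * (x1 + x2) = w y.
  by rewrite /x1 /x2; field; rewrite ?a0 ?two0 ?four0.
have ba0 : x1 * x2 != 0 by rewrite prod mulf_neq0 ?invr_eq0.
move: (ba0); rewrite mulf_eq0 negb_or => /andP[x10 x20].
have bE : b = a * (x1 * x2) by rewrite prod mulrC divfK.
have ne : x1 != x2.
  rewrite -subr_eq0; have -> : x1 - x2 = d / a.
    by rewrite /x1 /x2; field; rewrite ?a0 ?two0 ?four0.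
  by rewrite mulf_neq0 ?invr_eq0.
have -> : 2%N = #|[set x1; x2]| by rewrite cards2 ne.
apply: subset_leq_card; apply/subsetP => x; rewrite !inE => /orP[] /eqP->.
  by rewrite x10 -sum /g bE; apply/eqP; field.
by rewrite x20 -sum /g bE; apply/eqP; field.
Qed.

(** The solutions (x, y) are counted along x and along y.  If the fibre over x
    is not empty then a x + b / x has trace zero, and it has at most q
    elements. *)
Lemma trace_zero_count :
  (B ^ 2 <= q * #|[set x | (x != 0%R) && (T (g x) == 0%R)]| + 4 * q * B + 4 * q)%N.
Proof.
pose pairs := [set p : L * L | (p.1 != 0) && (g p.1 == w p.2)].
have by_x : (#|pairs| <= q * #|[set x | (x != 0%R) && (T (g x) == 0%R)]|)%N.
  rewrite -sum1_card (partition_big (fun p => p.1)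
    (mem [set x | (x != 0%R) && (T (g x) == 0%R)])) /=; last first.
    by move=> [x y]; rewrite !inE /= => /andP[-> /eqP->]; rewrite Tfrob eqxx.
  rewrite mulnC -sum_nat_const; apply: leq_sum => x _.
  rewrite sum1_card; apply: leq_trans (card_fiber_w (g x)).
  rewrite -(card_imset [set y | w y == g x] (_ : injective (pair x))); last by move=> y y' [].
  apply: subset_leq_card; apply/subsetP => -[x' y].
  rewrite unfold_in /= inE /=.
  move=> /andP[/andP[_ /eqP e] /eqP <-].
  by apply/imsetP; exists y; rewrite // inE e.
have by_y : (2 * #|[set y | (f y != 0%R) && ~~ (f y ^+ (B ^ 2 - 1)./2 == -1)%R]|
    <= #|pairs|)%N.
  rewrite -[leqRHS]sum1_card (partition_big (fun p => p.2) xpredT) //= mulnC -sum_nat_const.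
  rewrite big_mkcond; apply: leq_sum => y _; case: ifP => //; rewrite inE => /andP[fy0 fy].
  have sq : exists d, d ^+ 2 = f y.
    have := euler_criterion (_ : odd #|L|) fy0; rewrite cardL oddX oddB orbT.
    by case=> // e; rewrite e eqxx in fy.
  apply: leq_trans (fiber_square sq fy0) _; rewrite sum1_card.
  rewrite -(card_imset _ (_ : injective (fun x => (x, y)))); last by move=> x x' [].
  apply: subset_leq_card; apply/subsetP => _ /imsetP[x + ->].
  by rewrite inE => xS; rewrite unfold_in /= inE /= xS eqxx.
have total : (B ^ 2 <= #|[set y | f y == 0%R]|
    + #|[set y | (f y ^+ (B ^ 2 - 1)./2 == -1)%R]|
    + #|[set y | (f y != 0%R) && ~~ (f y ^+ (B ^ 2 - 1)./2 == -1)%R]|)%N.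
  move: (_./2) => e; rewrite -cardL -[#|L|]cardsT.
  rewrite (_ : [set: L] = [set y | f y == 0%R] :|: [set y | (f y ^+ e == -1)%R] :|:
      [set y | (f y != 0%R) && ~~ (f y ^+ e == -1)%R]); last first.
    by apply/setP => y; rewrite !inE; case: (f y == 0%R) => //=; case: (_ == -1).
  apply: leq_trans (leq_card_setU _ _) _; rewrite leq_add2r; exact: leq_card_setU.
move: by_x by_y total card_zeros_f card_nonsquares.
move: (4 * q * B)%N; clear => *; lia.
Qed.

End PointCount.

(** * The Weil bound for Kloosterman sums *)

Lemma kloosterman_real (F : finFieldType) (chi : F -> algC) a b :
  additive_char chi -> kloosterman chi a b \is Num.real.
Proof.
move=> chiP; apply/CrealP; rewrite /kloosterman rmorph_sum /= (reindex_inj oppr_inj) /=.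
apply: eq_big => x; first by rewrite oppr_eq0.
by move=> x0; rewrite additive_char_conj // invrN !mulrN -opprD opprK.
Qed.

(** Summing a character over all its multiples detects trace zero. *)
Lemma kloosterman_sum (F L : finFieldType) (i : {rmorphism F -> L}) (T : L -> F)
    (chi : F -> algC) a b : additive_char chi ->
    (forall c z, T (i c * z) = c * T z) ->
  \sum_c kloosterman (chi \o T) (i (c * a)) (i (c * b))
    = (#|F| * #|[set x : L | (x != 0%R) && (T (i a * x + i b / x) == 0%R)]|)%:R.
Proof.
move=> chiP TZ; rewrite exchange_big /=.
rewrite (eq_bigr (fun x : L => if T (i a * x + i b / x) == 0 then #|F|%:R else 0)).
  rewrite -big_mkcondr /= big_const iter_addr_0 natrM mulrC mulr_natl; congr (_ *+ _).
  by apply: eq_card => x; rewrite !inE.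
move=> x _; rewrite -(additive_char_sum chiP); apply: eq_bigr => c _.
by congr chi; rewrite /= [RHS]mulrC -TZ !rmorphM; congr T; ring.
Qed.

(** At a level J+1 of the tower, let B^2 be the cardinality of the field and
    D c the sum for the multiple c of the character.  The D c with c <> 0 add
    up to at least - 4 q B - 4 q by the point count, and each is at most 2 B
    because it is 2 B minus a square; therefore D 1 >= - 10 q B.  If the bound
    failed over F, (D 1)^2 would exceed 100 q^2 B^2 at all high levels. *)
Theorem kloosterman_bound (F : finFieldType) (chi : F -> algC) a b : odd #|F| ->
  additive_char chi -> b != 0 -> `|kloosterman chi a b| ^+ 2 <= 4%:R * #|F|%:R.
Proof.
move=> oddF chiP b0; set q := #|F|; have q_gt1 : (1 < q)%N := finNzRing_gt1 F.
have [chiD chi0 _] := chiP.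
have [->|a0] := eqVneq a 0.
  have -> : kloosterman chi 0 b = -1.
    apply/eqP; rewrite -addr_eq0 addrC -[X in X + _]chi0 -[X in chi X + _](mulr0 b).
    rewrite /kloosterman (eq_bigr (fun x => chi (b * x^-1))) => [|x _]; last first.
      by rewrite mul0r add0r.
    have := additive_char_sum chiP b.
    rewrite (negPf b0) (reindex_inj invr_inj) (bigD1 0) //= invr0 => ->.
    by rewrite eqxx.
  by rewrite normrN1 expr1n -natrM ler1n muln_gt0 (ltnW q_gt1).
pose kl c : algR := in_algR (kloosterman_real (c * a) (c * b) chiP).
rewrite [X in X <= _](_ : _ = algRval (kl 1 ^+ 2)); last first.
  by rewrite rmorphXn /= !mul1r real_normK ?kloosterman_real.
have -> : 4%:R * q%:R = algRval (4%:R * q%:R) by rewrite rmorphM !rmorph_nat.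
suff : kl 1 ^+ 2 <= 4%:R * q%:R by [].
case: lerP => // big.
have q0 : 0 < q%:R :> algR by rewrite ltr0n ltnW.
have [J0 large] := doubling_unbounded q0 big (100%:R * q%:R ^+ 2).
pose J := maxn J0 (2 * q ^ 2 + 2 * q).
have [L [i [T [cardL TD TZ [Tfrob _] klT]]]] := exists_tower J.+1 oddF.
pose B := (q ^ (2 ^ J))%N.
have cardB : #|L| = (B ^ 2)%N by rewrite cardL expnS mulnC expnM.
have ltB : (2 * q ^ 2 + 2 * q < B)%N.
  apply: leq_ltn_trans (leq_maxr J0 _) _; apply: ltn_trans (ltn_expl J (leqnn 2)) _.
  exact: ltn_expl.
have chB : [pchar L].-nat B by rewrite pnatX (pchar_rmorph i) // pchar_nat_card.
have oddB : odd B by rewrite oddX oddF orbT.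
have ia0 : i a != 0 by rewrite fmorph_eq0.
have ib0 : i b != 0 by rewrite fmorph_eq0.
have := trace_zero_count i cardB chB oddB ltB Tfrob ia0 ib0.
have := kloosterman_sum a b chiP TZ; set N := #|[set x | _]| => sumN count.
pose D c := doubling q%:R (kl c) J.+1.
have DE c : c != 0 -> algRval (D c) = kloosterman (chi \o T) (i (c * a)) (i (c * b)).
  by move=> c0; rewrite klT ?mulf_neq0 // rmorph_doubling rmorph_nat.
have kl00 : kloosterman (chi \o T) (i (0 * a)) (i (0 * b)) = (B ^ 2 - 1)%N%:R.
  rewrite !mul0r rmorph0 /kloosterman (eq_bigr (fun=> 1)) => [|x _]; last first.
    by rewrite !mul0r addr0 /= -[0](mulr0 (i 0)) TZ mul0r.
  rewrite big_const iter_addr_0 -cardB -mulr_natr mul1r; congr (_ %:R).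
  by rewrite subn1 -(cardC1 (0 : L)); apply: eq_card => x; rewrite !inE.
have sumD : \sum_(c | c != 0) D c = (q * N)%:R - (B ^ 2 - 1)%N%:R.
  apply: (fmorph_inj (algRval : {rmorphism algR -> algC})).
  rewrite rmorph_sum rmorphB !rmorph_nat -sumN [X in _ = X - _](bigD1 0) //= kl00.
  rewrite addrC addrK.
  by apply: eq_bigr => c /DE.
(* This holds at every level but the bottom one, hence the use of J.+1. *)
have D_le c : D c <= 2%:R * B%:R.
  by rewrite /D /= -natrX -/B gerBl sqr_ge0.
have D1_ge : - 10%:R * q%:R * B%:R <= D 1.
  have : \sum_(c | c != 0) D c <= D 1 + (2 * B * q)%:R.
    rewrite (bigD1 1) ?oner_eq0 //= lerD2l.
    apply: le_trans (ler_sum _ (fun c _ => D_le c)) _.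
    rewrite big_const iter_addr_0 -[leLHS]mulr_natr -!natrM ler_nat.
    by rewrite leq_mul2l max_card orbT.
  have B1 : (1 <= B)%N by apply: leq_ltn_trans ltB.
  have : (B ^ 2 - 1)%N%:R + 1 <= (q * N)%:R + 4%:R * q%:R * B%:R + 4%:R * q%:R :> algR.
    have B2 : (1 <= B ^ 2)%N by rewrite expn_gt0 B1.
    by rewrite -(natrD _ _ 1) (subnK B2) -!natrM -!natrD ler_nat.
  have : q%:R <= q%:R * B%:R :> algR by rewrite ler_peMr ?ler1n // ltW.
  rewrite sumD !natrM; move: (q%:R * N%:R) (_ - 1)%N%:R => u v.
  by move: q%:R B%:R (D 1) => x y z; lra.
have := large J.+1 (leqW (leq_maxl _ _)).
rewrite -/(D 1) expnS mulnC exprM -[_ ^+ (2 ^ J)]natrX -/B.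
have := D_le 1; have : 0 < B%:R :> algR by rewrite ltr0n; apply: leq_ltn_trans ltB.
have : 1 <= q%:R :> algR by rewrite ler1n ltnW.
move: D1_ge; move: (D 1) (B%:R : algR) (q%:R : algR) => x y z h1 h2 h3 h4 h5.
have : 0 <= (10 * z * y - x) * (10 * z * y + x) by apply: mulr_ge0; nra.
nra.
Qed.

(** * Gauss and Salie sums *)

(** Any nonprincipal irreducible character of the additive group will do: the
    group is abelian, so it is linear. *)
Lemma exists_additive_char (F : finFieldType) : exists chi : F -> algC, additive_char chi.
Proof.
pose G := [set: F]%G.
have abG : abelian G by apply: FinRing.zmod_abelian.
have nG : (1 < Nirr G)%N.
  by rewrite card_classes_abelian in abG; rewrite NirrE (eqP abG) cardsT finNzRing_gt1.
pose i : Iirr G := Ordinal nG.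
have lin : 'chi_i \is a linear_char by apply/char_abelianP.
exists 'chi_i; split.
- by move=> x y; apply: (lin_charM lin); rewrite inE.
- exact: lin_char1 lin.
have [/existsP//|] := boolP [exists x : F, 'chi_i x != 1].
rewrite negb_exists => /forallP triv; suff /irr_inj : 'chi_i = 'chi_0 by [].
apply/cfunP => x; rewrite irr0 cfun1E inE; apply/eqP; have := triv x; by rewrite negbK.
Qed.

Section GaussSums.
Variables (F : finFieldType) (psi : F -> algC).
Hypotheses (oddF : odd #|F|) (psiP : additive_char psi).
Let q := #|F|.
Let two0 : 2%:R != 0 :> F := odd_card_two_neq0 oddF.
Let four0 : 4%:R != 0 :> F.
Proof. by rewrite (natrM _ 2 2) mulf_neq0. Qed.
Let psiD : {morph psi : x y / x + y >-> x * y}.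
Proof. by case: psiP. Qed.
Let psi0 : psi 0 = 1.
Proof. by case: psiP. Qed.

Definition gauss u := \sum_x psi (u * x ^+ 2).

Lemma gauss_conj u : (gauss u)^* = gauss (- u).
Proof.
rewrite rmorph_sum; apply: eq_bigr => x _.
by rewrite /= additive_char_conj // mulNr.
Qed.

Lemma gauss_norm u : u != 0 -> `|gauss u| ^+ 2 = q%:R.
Proof.
move=> u0; rewrite normCK gauss_conj mulr_suml.
rewrite (eq_bigr (fun x => \sum_z psi (u * (x ^+ 2 - (x + z) ^+ 2)))); last first.
  move=> x _; rewrite mulr_sumr (reindex_inj (addrI x)) /=; apply: eq_bigr => z _.
  by rewrite -psiD; congr psi; ring.
rewrite exchange_big (bigD1 0) //= [X in _ + X]big1 ?addr0 => [|z z0].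
  rewrite (eq_bigr (fun=> 1)) => [|x _]; last by rewrite addr0 subrr mulr0 psi0.
  by rewrite big_const iter_addr_0 /q; congr _%:R; apply: eq_card.
rewrite (eq_bigr (fun x => psi (- u * z ^+ 2) * psi (- (2%:R * u * z) * x))); last first.
  by move=> x _; rewrite -psiD; congr psi; ring.
rewrite -mulr_sumr additive_char_sum // oppr_eq0 !mulf_eq0.
by rewrite (negPf two0) (negPf u0) (negPf z0) mulr0.
Qed.

Lemma gauss_neq0 u : u != 0 -> gauss u != 0.
Proof.
move=> u0; rewrite -normr_eq0 -sqrf_eq0 gauss_norm // pnatr_eq0 -lt0n.
exact: ltnW (finNzRing_gt1 F).
Qed.

Lemma gauss_inv u : u != 0 -> (gauss u)^-1 = gauss (- u) / q%:R.
Proof.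
move=> u0; apply: (mulfI (gauss_neq0 u0)).
rewrite divff ?gauss_neq0 // mulrA -gauss_conj -normCK gauss_norm // divff //.
by rewrite pnatr_eq0 -lt0n ltnW // finNzRing_gt1.
Qed.

Lemma gauss_complete_square u m : u != 0 ->
  \sum_x psi (u * x ^+ 2 + m * x) = psi (- m ^+ 2 / (4%:R * u)) * gauss u.
Proof.
move=> u0; rewrite mulr_sumr (reindex_inj (addIr (- (m / (2%:R * u))))) /=.
by apply: eq_bigr => x _; rewrite -psiD; congr psi; field; rewrite ?u0 ?two0 ?four0.
Qed.

(** The sign is the quadratic character of [c].  When [c] is not a square, each
    z <> 0 is of exactly one of the forms x^2 and c x^2, so the two Gauss sums
    add up to twice the complete sum of a nontrivial character. *)
Lemma gauss_scale c : c != 0 -> exists2 e : algC, e ^+ 2 = 1 &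
  forall u, u != 0 -> gauss (c * u) = e * gauss u.
Proof.
move=> c0; have [/existsP[w /eqP wc]|nsq] := boolP [exists w, w ^+ 2 == c].
  have w0 : w != 0 by rewrite -sqrf_eq0 wc.
  exists 1 => [|u u0]; first exact: expr1n.
  rewrite mul1r [RHS](reindex_inj (mulfI w0)) /=; apply: eq_bigr => x _.
  by rewrite exprMn wc; congr psi; ring.
exists (-1) => [|u u0]; first by rewrite sqrrN expr1n.
apply/eqP; rewrite mulN1r -addr_eq0; apply/eqP.
pose n1 (z : F) := #|[set x : F | c * x ^+ 2 == z]|.
pose n2 (z : F) := #|[set x : F | x ^+ 2 == z]|.
have n1_le (x0 z : F) : c * x0 ^+ 2 = z -> [set x | c * x ^+ 2 == z] \subset [set x0; - x0].
  move=> e; apply/subsetP => x; rewrite !inE -eqf_sqr -e => /eqP/(mulfI c0) ->; exact: eqxx.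
have n2_le (x0 z : F) : x0 ^+ 2 = z -> [set x | x ^+ 2 == z] \subset [set x0; - x0].
  by move=> e; apply/subsetP => x; rewrite !inE -eqf_sqr -e.
have card_le2 (x0 : F) : (#|[set x0; - x0]| <= 2)%N by rewrite cards2; case: (_ != _).
have card0 : #|[set (0 : F); - 0]| = 1%N by rewrite oppr0 setUid cards1.
have le2 z : (n1 z + n2 z <= 2)%N.
  rewrite /n1 /n2; have [->|[x1]] := set_0Vmem [set x | c * x ^+ 2 == z].
    rewrite cards0 add0n; have [->|[x2]] := set_0Vmem [set x | x ^+ 2 == z].
      by rewrite cards0.
    by rewrite inE => /eqP/n2_le/subset_leq_card le; apply: leq_trans le (card_le2 _).
  rewrite inE => /eqP e1; have [->|[x2]] := set_0Vmem [set x | x ^+ 2 == z].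
    by rewrite cards0 addn0; apply: leq_trans (subset_leq_card (n1_le _ _ e1)) (card_le2 _).
  rewrite inE => /eqP e2.
  have x10 : x1 = 0.
    apply: contraNeq nsq => x10; apply/existsP; exists (x2 / x1).
    by rewrite exprMn e2 -e1 exprVn mulfK // expf_neq0.
  have z0 : z = 0 by rewrite -e1 x10 expr0n mulr0.
  have x20 : x2 = 0 by apply/eqP; rewrite -sqrf_eq0 e2 z0.
  have := subset_leq_card (n1_le _ _ e1); have := subset_leq_card (n2_le _ _ e2).
  by rewrite x10 x20 card0; move: #|_| #|_|; clear; lia.
have n12 : forall z, (n1 z + n2 z)%N = 2%N.
  apply: sum_nat_saturated le2 _; rewrite big_split /=.
  by rewrite !sum_card_fiber mul2n addnn.
have E (h : F -> F) : \sum_x psi (u * h x) = \sum_z psi (u * z) *+ #|[set x | h x == z]|.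
  by rewrite -(sum_by_fiber xpredT h (fun z => psi (u * z))).
rewrite /gauss (eq_bigr (fun x => psi (u * (c * x ^+ 2)))); last first.
  by move=> x _; congr psi; ring.
rewrite (E (fun x => c * x ^+ 2)) (E (fun x => x ^+ 2)) -big_split /=.
rewrite (eq_bigr (fun z => psi (u * z) *+ 2)); last by move=> z _; rewrite -mulrnDr n12.
by rewrite sumrMnl additive_char_sum // (negPf u0) mul0rn.
Qed.

Lemma gauss_sqr u : u != 0 -> gauss u ^+ 2 = gauss 1 ^+ 2.
Proof.
move=> u0; have [e e2 gE] := gauss_scale u0.
by rewrite -[u in LHS]mulr1 gE ?oner_eq0 // exprMn e2 mul1r.
Qed.

(** The Fourier coefficients of the indicator function of a sphere in dimension
    [d], less its mean, up to normalization.  Squares of Gauss sums do not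
    depend on [u], so only the parity of [d] matters: d = 0 is a Kloosterman
    sum, d = 1 a Salie sum. *)
Definition gauss_kloosterman d M r :=
  \sum_(u : F | u != 0) (gauss u ^+ d)^-1 * psi (M * u + r / u).

Lemma gauss_kloosterman_split k d M r :
  gauss_kloosterman (k.*2 + d) M r = (gauss 1 ^+ k.*2)^-1 * gauss_kloosterman d M r.
Proof.
rewrite mulr_sumr; apply: eq_bigr => u u0; rewrite mulrA; congr (_ * _).
by rewrite exprD -mul2n !exprM gauss_sqr // invfM.
Qed.

(** Rescaling u by r makes 1 / (4 u) the term that comes from completing the
    square in - u x^2 + x; summing over u first leaves a sum of at most two
    terms.  In other words the Salie sum is a Fourier coefficient of a sphere
    of dimension zero. *)
Lemma salie_bound M r : r != 0 -> `|gauss_kloosterman 1 M (r / 4%:R)| ^+ 2 <= 4%:R.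
Proof.
move=> r0; have [e e2 gE] := gauss_scale r0.
have q0 : q%:R != 0 :> algC by rewrite pnatr_eq0 -lt0n ltnW // finNzRing_gt1.
have e_norm : `|e^-1| = 1.
  have : `|e| ^+ 2 = 1 by rewrite -normrX e2 normr1.
  by move/eqP; rewrite pexpr_eq1 // normfV => /eqP->; rewrite invr1.
have -> : gauss_kloosterman 1 M (r / 4%:R) = e^-1 *
    \sum_(x | x ^+ 2 == M * r) psi x.
  transitivity (e^-1 * (\sum_(u | u != 0) (gauss u)^-1 * psi (M * r * u + (4%:R * u)^-1))).
    rewrite /gauss_kloosterman (reindex_inj (mulfI r0)) mulr_sumr /=.
    apply: eq_big => u; first by rewrite mulf_eq0 (negPf r0).
    rewrite mulf_eq0 (negPf r0) /= => u0; rewrite expr1 gE // invfM mulrA.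
    by congr (_ * psi _); field; rewrite ?r0 ?u0 ?four0.
  congr (_ * _).
  transitivity (q%:R^-1 * \sum_x psi x * \sum_(u | u != 0) psi ((M * r - x ^+ 2) * u)).
    rewrite (eq_bigr (fun u => q%:R^-1 * \sum_x psi x * psi ((M * r - x ^+ 2) * u))).
      by rewrite -mulr_sumr exchange_big; congr (_ * _); apply: eq_bigr => x _; rewrite mulr_sumr.
    move=> u u0; have := @gauss_complete_square (- u) 1; rewrite oppr_eq0 => /(_ u0).
    have -> : - 1 ^+ 2 / (4%:R * - u) = (4%:R * u)^-1.
      by field; rewrite ?oppr_eq0 ?u0 ?four0.
    move=> square; rewrite gauss_inv // psiD.
    transitivity (q%:R^-1 * (psi (M * r * u) * (psi (4%:R * u)^-1 * gauss (- u)))).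
      by ring.
    rewrite -square; congr (_ * _); rewrite mulr_sumr; apply: eq_bigr => x _.
    by rewrite -!psiD; congr psi; ring.
  rewrite (eq_bigr (fun x => psi x * ((if x ^+ 2 == M * r then q%:R else 0) - 1))); last first.
    move=> x _; congr (_ * _); have := additive_char_sum psiP (M * r - x ^+ 2).
    rewrite subr_eq0 eq_sym (bigD1 0) //= mulr0 psi0 => <-.
    by rewrite [RHS]addrAC subrr add0r.
  rewrite (eq_bigr (fun x =>
    (if x ^+ 2 == M * r then psi x * q%:R else 0) - psi (1 * x))); last first.
    by move=> x _; rewrite mulrBr mulr1 mul1r; case: ifP => //; rewrite mulr0.
  rewrite sumrB additive_char_sum // oner_eq0 subr0 -big_mkcond -mulr_suml.
  by rewrite mulrC mulfK.
rewrite normrM e_norm mul1r.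
have le2 : `|\sum_(x | x ^+ 2 == M * r) psi x| <= 2%:R.
  apply: le_trans (ler_norm_sum _ _ _) _.
  rewrite (eq_bigr (fun=> 1)) => [|x _]; last by rewrite additive_char_norm.
  rewrite big_const iter_addr_0 ler_nat.
  rewrite -[leqLHS](cardsE (fun x => x ^+ 2 == M * r)).
  have [->|[x0]] := set_0Vmem [set x | x ^+ 2 == M * r]; first by rewrite cards0.
  rewrite inE => /eqP e0; apply: leq_trans (_ : #|[set x0; - x0]| <= _)%N.
    by apply: subset_leq_card; apply/subsetP => x; rewrite inE unfold_in !inE -e0 eqf_sqr.
  by rewrite cards2; case: (_ != _).
by rewrite (natrX _ 2 2) lerXn2r // nnegrE.
Qed.

Lemma gauss_kloosterman_bound d M r : r != 0 ->
  `|gauss_kloosterman d M (r / 4%:R)| ^+ 2 * q%:R ^+ d <= 4%:R * q%:R.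
Proof.
move=> r0; have r40 : r / 4%:R != 0 by rewrite mulf_neq0 ?invr_eq0.
have q0 : 0 < q%:R :> algC by rewrite ltr0n ltnW // finNzRing_gt1.
rewrite -[d]odd_double_half addnC gauss_kloosterman_split normrM exprMn normfV.
have -> : (`|gauss 1 ^+ (d./2).*2|^-1) ^+ 2 = (q%:R ^+ (d./2).*2)^-1.
  by rewrite exprVn normrX -mul2n exprM gauss_norm ?oner_eq0 // -exprM mulnC.
rewrite exprD mulrACA mulVf ?expf_neq0 ?gt_eqF // mul1r.
case: (odd d); rewrite ?expr1 ?expr0 ?mulr1.
  by rewrite ler_pM2r //; apply: salie_bound.
rewrite /gauss_kloosterman (eq_bigr (fun u => psi (M * u + (r / 4%:R) / u))).
  exact: kloosterman_bound.
by move=> u _; rewrite expr0 invr1 mul1r.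
Qed.

End GaussSums.

(** * Mixing for the graph of a fixed distance *)

Lemma cauchy_schwarz_real (R : realFieldType) (I : finType) (a b : I -> R) :
  (\sum_i a i * b i) ^+ 2 <= (\sum_i a i ^+ 2) * (\sum_i b i ^+ 2).
Proof.
have E (f g : I -> R) : (\sum_i f i) * (\sum_i g i) = \sum_i \sum_j f i * g j.
  by rewrite mulr_suml; apply: eq_bigr => i _; rewrite mulr_sumr.
have : 0 <= \sum_i \sum_j (a i * b j - a j * b i) ^+ 2.
  by apply: sumr_ge0 => i _; apply: sumr_ge0 => j _; apply: sqr_ge0.
rewrite (eq_bigr (fun i => (\sum_j a i ^+ 2 * b j ^+ 2) +
   (\sum_j b i ^+ 2 * a j ^+ 2) - 2%:R * (\sum_j (a i * b i) * (a j * b j)))).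
  rewrite sumrB big_split -mulr_sumr -!E /= expr2.
  by rewrite [X in _ + X - _]mulrC; lra.
move=> i _; rewrite mulr_sumr -big_split -sumrB /=; apply: eq_bigr => j _; ring.
Qed.

Lemma norm_cauchy_schwarz (I : finType) (c x y : I -> algC) (K : algC) :
    (forall i, `|c i| ^+ 2 <= K) ->
  `|\sum_i c i * (x i * y i)| ^+ 2 <= K * ((\sum_i `|x i| ^+ 2) * (\sum_i `|y i| ^+ 2)).
Proof.
move=> cK; pose r (z : algC) : algR := in_algR (normr_real z).
have cs : (\sum_i `|c i * x i| * `|y i|) ^+ 2 <=
    (\sum_i `|c i * x i| ^+ 2) * (\sum_i `|y i| ^+ 2).
  have le_val (u v : algR) : u <= v -> algRval u <= algRval v by [].
  have := le_val _ _ (cauchy_schwarz_real (fun i => r (c i * x i)) (fun i => r (y i))).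
  by rewrite rmorphXn rmorphM !rmorph_sum.
apply: le_trans (le_trans _ cs) _.
  apply: lerXn2r; rewrite ?nnegrE ?normr_ge0 //; first by apply: sumr_ge0 => i _; rewrite mulr_ge0.
  apply: le_trans (ler_norm_sum _ _ _) _; apply: ler_sum => i _.
  by rewrite mulrA normrM.
rewrite mulrA; apply: ler_wpM2r; first by apply: sumr_ge0 => i _; rewrite exprn_ge0.
rewrite mulr_sumr; apply: ler_sum => i _.
by rewrite normrM exprMn; apply: ler_wpM2r; rewrite ?exprn_ge0.
Qed.

Section Mixing.
Variables (F : finFieldType) (d : nat) (psi : F -> algC).
Hypotheses (oddF : odd #|F|) (psiP : additive_char psi).
Let q := #|F|.
Let V := 'rV[F]_d.
Implicit Types x m : V.
Let psiD : {morph psi : x y / x + y >-> x * y}.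
Proof. by case: psiP. Qed.
Let psi0 : psi 0 = 1.
Proof. by case: psiP. Qed.

Definition dot m x := \sum_i m 0 i * x 0 i.

Lemma additive_char_big (I : finType) (f : I -> F) :
  psi (\sum_i f i) = \prod_i psi (f i).
Proof. exact: (big_morph psi psiD psi0). Qed.

Lemma prod_sum_row (G : 'I_d -> F -> algC) :
  \sum_(m : V) \prod_i G i (m 0 i) = \prod_i \sum_x G i x.
Proof.
rewrite bigA_distr_bigA /= (reindex (fun f : {ffun 'I_d -> F} => \row_i f i)) /=.
  by apply: eq_bigr => f _; apply: eq_bigr => i _; rewrite mxE.
exists (fun m : V => [ffun i => m 0 i]) => [f _|m _].
  by apply/ffunP => i; rewrite ffunE mxE.
by apply/rowP => i; rewrite mxE ffunE.
Qed.

Lemma char_dot_sum x : \sum_m psi (dot m x) = if x == 0 then (q ^ d)%:R else 0.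
Proof.
rewrite (eq_bigr (fun m : V => \prod_i psi (x 0 i * m 0 i))) => [|m _]; last first.
  by rewrite -additive_char_big; congr psi; apply: eq_bigr => i _; rewrite mulrC.
rewrite (prod_sum_row (fun i y => psi (x 0 i * y))).
rewrite (eq_bigr _ (fun i _ => additive_char_sum psiP (x 0 i))).
case: eqVneq => [->|/rV0Pn[i xi]].
  by rewrite (eq_bigr (fun=> q%:R)) => [|i _]; rewrite ?mxE ?eqxx // prodr_const card_ord natrX.
by rewrite (bigD1 i) //= (negPf xi) mul0r.
Qed.

Lemma gauss_sum_row u x : u != 0 ->
  \sum_(m : V) psi (u * qnorm m + dot m x)
    = psi (- qnorm x / (4%:R * u)) * gauss psi u ^+ d.
Proof.
move=> u0; rewrite (eq_bigr (fun m : V => \prod_i psi (u * m 0 i ^+ 2 + x 0 i * m 0 i))).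
  rewrite (prod_sum_row (fun i y => psi (u * y ^+ 2 + x 0 i * y))).
  rewrite (eq_bigr _ (fun i _ => gauss_complete_square oddF psiP (x 0 i) u0)).
  rewrite big_split prodr_const card_ord -additive_char_big /=; congr (psi _ * _).
  by rewrite mulNr /qnorm mulr_suml -sumrN; apply: eq_bigr => i _; rewrite mulNr.
move=> m _; rewrite -additive_char_big big_split /= /qnorm mulr_sumr; congr (psi (_ + _)).
by apply: eq_bigr => i _; rewrite mulrC.
Qed.

Definition char_sum (A : {set V}) m := \sum_(x in A) psi (dot m x).

Lemma plancherel (A : {set V}) :
  \sum_m `|char_sum A m| ^+ 2 = (q ^ d * #|A|)%:R.
Proof.
rewrite (eq_bigr (fun m => \sum_(x in A) \sum_(y in A) psi (dot m (x - y)))); last first.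
  move=> m _; rewrite normCK rmorph_sum mulr_suml; apply: eq_bigr => x _.
  rewrite mulr_sumr; apply: eq_bigr => y _ /=; rewrite additive_char_conj // -psiD.
  by congr psi; rewrite /dot -sumrB; apply: eq_bigr => i _; rewrite !mxE mulrBr.
rewrite exchange_big /= (eq_bigr (fun=> (q ^ d)%:R)) => [|x xA].
  by rewrite big_const iter_addr_0 natrM mulr_natr.
rewrite exchange_big /= (bigD1 x) //= char_dot_sum subrr eqxx big1 ?addr0 // => y.
by case/andP=> _ yx; rewrite char_dot_sum subr_eq0 eq_sym (negPf yx).
Qed.

(** The indicator function of the distance [r] is written as the average of
    psi (s (r - qnorm x)) over s; with s = 1 / (4 u), each term with s <> 0 is
    expanded in the characters of the space by completing squares
    ([gauss_sum_row]), with no appeal to Fourier inversion. *)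
Lemma sphere_char_expansion x (r : F) : r != 0 ->
  \sum_m gauss_kloosterman psi d (qnorm m) (r / 4%:R) * psi (dot m x)
    = (if qnorm x == r then q%:R else 0) - 1.
Proof.
move=> r0; have two0 := odd_card_two_neq0 oddF.
have four0 : 4%:R != 0 :> F by rewrite (natrM _ 2 2) mulf_neq0.
have := additive_char_sum psiP (r - qnorm x).
rewrite subr_eq0 eq_sym (bigD1 0) //= mulr0 psi0 => <-; rewrite [RHS]addrAC subrr add0r.
rewrite (eq_bigr _ (fun m _ => mulr_suml _ _ _ _)) exchange_big /=.
rewrite [RHS](reindex_inj (inv_inj (@invrK F))) /= [RHS](reindex_inj (mulfI four0)) /=.
apply: eq_big => u; first by rewrite invr_eq0 mulf_eq0 (negPf four0).
move=> u0; have g0 := gauss_neq0 oddF psiP u0.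
transitivity ((gauss psi u ^+ d)^-1 * psi (r / 4%:R / u) *
    \sum_(m : V) psi (u * qnorm m + dot m x)).
  rewrite mulr_sumr; apply: eq_bigr => m _; rewrite -!mulrA -!psiD; congr (_ * psi _).
  by ring.
rewrite gauss_sum_row //.
transitivity (psi (r / 4%:R / u) * psi (- qnorm x / (4%:R * u))).
  by field; rewrite expf_neq0.
by rewrite -psiD; congr psi; field; rewrite ?u0 ?four0.
Qed.

(** Without edges, the sum over m of c_m times the two transforms equals
    - |A| |B|, while Cauchy-Schwarz and Plancherel bound its square by
    4 q^(1-d) (q^d |A|) (q^d |B|). *)
Theorem no_edge_mixing (A B : {set V}) (r : F) : r != 0 ->
    (forall x y, x \in A -> y \in B -> qnorm (x - y) != r) ->
  (#|A| * #|B| <= 4 * q ^ d.+1)%N.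
Proof.
move=> r0 noedge; pose c m := gauss_kloosterman psi d (qnorm m) (r / 4%:R).
have q0 : 0 < q%:R :> algC by rewrite ltr0n ltnW // finNzRing_gt1.
have eqAB : \sum_m c m * (char_sum A m * (char_sum B m)^*) = - (#|A| * #|B|)%:R.
  transitivity (\sum_(x in A) \sum_(y in B) \sum_m c m * psi (dot m (x - y))).
    rewrite [RHS](eq_bigr _ (fun x _ => exchange_big _ _ _ _ _ _)) [RHS]exchange_big /=.
    apply: eq_bigr => m _; rewrite /char_sum rmorph_sum big_distrlr mulr_sumr /=.
    apply: eq_bigr => x _; rewrite mulr_sumr; apply: eq_bigr => y _.
    rewrite additive_char_conj // -psiD; congr (_ * psi _).
    by rewrite /dot -sumrB; apply: eq_bigr => i _; rewrite !mxE mulrBr.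
  rewrite (eq_bigr (fun=> - #|B|%:R)) => [|x xA].
    by rewrite big_const iter_addr_0 mulNrn -mulrnA mulnC.
  rewrite (eq_bigr (fun=> -1)) => [|y yB].
    by rewrite big_const iter_addr_0 mulNrn.
  by rewrite sphere_char_expansion // (negPf (noedge _ _ xA yB)) sub0r.
have cK m : `|c m| ^+ 2 <= 4%:R * q%:R / q%:R ^+ d.
  by rewrite ler_pdivlMr ?exprn_gt0 // gauss_kloosterman_bound.
have := norm_cauchy_schwarz (char_sum A) (fun m => (char_sum B m)^*) cK.
rewrite eqAB normrN normr_nat plancherel.
rewrite (eq_bigr (fun m => `|char_sum B m| ^+ 2)) => [|m _]; last by rewrite norm_conjC.
rewrite plancherel.
have -> : 4%:R * q%:R / q%:R ^+ d * ((q ^ d * #|A|)%:R * (q ^ d * #|B|)%:R) =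
   (4 * q ^ d.+1 * (#|A| * #|B|))%:R :> algC.
  by rewrite !natrM !natrX exprS; field; rewrite expf_neq0 // gt_eqF.
rewrite -natrX ler_nat expnS expn1.
by case: (posnP (#|A| * #|B|)%N) => [->|AB0] //; rewrite leq_pmul2r.
Qed.

End Mixing.

(** * Numerical choices and the embedding *)

(** Clearing the real powers.  The first conclusion says that the cut-off [m]
    is at least one: otherwise 30 X would exceed the size of the whole space. *)
Lemma size_bound_nat (K : realType) (q d t Delta n s m : nat) : (0 < n)%N ->
    (s <= q ^ d)%N -> (0 < q)%N -> (0 < t)%N ->
    n%:R <= s%:R - 30%:R * (t * Delta)%N%:R `^ (1 / 2%:R)
       * q%:R `^ ((d + 1)%N%:R / 2%:R) :> K ->
  (Delta <= t * q ^ d.+1)%N /\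
  ((m ^ 2 * Delta <= t * q ^ d.+1)%N -> (n + 30 * (m * Delta) <= s)%N).
Proof.
move=> n0 leS q0 t0; set u := _ `^ _; set v := _ `^ _.
have u2 : u ^+ 2 = (t * Delta)%:R.
  by rewrite /u -powR_mulrn ?powR_ge0 // -powRrM mul1r mulVf ?pnatr_eq0 // powRr1.
have v2 : v ^+ 2 = (q ^ d.+1)%:R.
  rewrite /v -powR_mulrn ?powR_ge0 // -powRrM divfK ?pnatr_eq0 //.
  by rewrite powR_mulrn // natrX addn1.
set X := u * v; have X0 : 0 <= X by rewrite mulr_ge0 ?powR_ge0.
have X2 : X ^+ 2 = (t * Delta * q ^ d.+1)%:R by rewrite exprMn u2 v2 -natrM.
rewrite -mulrA -/X => size_le.
have n1 : 1 <= n%:R :> K by rewrite ler1n.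
have le_pow (x y : K) : 0 <= y -> x ^+ 2 <= y ^+ 2 -> x <= y.
  by move=> y0 le_xy; rewrite real_leNgt ?num_real //; apply/negP => ltyx; nra.
split.
  have sD : s%:R <= (q ^ d.+1)%:R :> K.
    by rewrite ler_nat (leq_trans leS) // leq_pexp2l.
  have : X ^+ 2 <= (q ^ d.+1)%:R ^+ 2 by rewrite lerXn2r ?nnegrE //; nra.
  rewrite X2 -natrX ler_nat -mulnn leq_pmul2r ?expn_gt0 ?q0 // => leD.
  apply: leq_trans (leq_pmull _ t0) (leq_trans leD _).
  exact: leq_pmull.
move=> mD; have : (m * Delta)%:R <= X.
  apply: le_pow => //; rewrite X2 -natrX ler_nat.
  have := leq_mul mD (leqnn Delta); rewrite expnMn; move: (q ^ d.+1)%N; clear; lia.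
move=> leX; rewrite -(ler_nat K) natrD natrM; lra.
Qed.

Section Distances.
Variables (F : finFieldType) (d : nat).
Let V := 'rV[F]_d.

Definition sphere_nbrs (p : V * F) : {set V} := [set y | qnorm (p.1 - y) == p.2].

Lemma qnormN (x : V) : qnorm (- x) = qnorm x.
Proof. by apply: eq_bigr => i _; rewrite mxE sqrrN. Qed.

(** The mixing bound applied to each colour class of [X], and summed over the
    colours: the factor [#|R|] is paid once, for the whole set of pairs. *)
Lemma sphere_nbhd_large (S : {set V}) (R : {set F}) (X : {set V * F}) :
    odd #|F| -> 0 \notin R ->
    X \subset setX S R ->
  (#|X| * #|S :\: nbhd sphere_nbrs X| <= 4 * (#|R| * #|F| ^ d.+1))%N.
Proof.
move=> oddF R0 sX; have [psi psiP] := exists_additive_char F.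
pose slice r := [set x | (x, r) \in X].
have cX : #|X| = (\sum_(r in R) #|slice r|)%N.
  rewrite -sum1_card (partition_big (fun p => p.2) (mem R)) /=; last first.
    by move=> p /(subsetP sX); rewrite inE => /andP[].
  apply: eq_bigr => r rR; rewrite sum1_card.
  rewrite -(card_imset _ (_ : injective (fun x : V => (x, r)))); last by move=> x y [].
  apply: eq_card => -[x s]; rewrite unfold_in /=; apply/andP/imsetP => [[xX /eqP <-]|[y]].
    by exists x; rewrite ?inE.
  by rewrite inE => yX [-> ->]; rewrite eqxx.
rewrite cX big_distrl mulnCA -sum_nat_const; apply: leq_sum => r rR.
apply: (no_edge_mixing oddF psiP (r := r)); first by apply: contraNneq R0 => <-.
move=> x y; rewrite !inE => xX /andP[yX _]; apply: contra yX => e.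
by apply/bigcupP; exists (x, r) => //; rewrite inE.
Qed.

End Distances.

Lemma tree_without_labels (F : finFieldType) (R : {set F}) (T : dist_graph R) :
  (forall r, r \notin R) -> connected_graph T -> forall u v : T, u = v.
Proof.
move=> R0 [_ conn] u v; have noedge (x y : T) : adj x y = false.
  by apply/negP => /dlabel_in; apply/negP.
have /connectP[[|w p] /=] := conn u v; first by move=> _ ->.
by rewrite noedge.
Qed.

Theorem theorem1 (K : realType) (F : finFieldType) (q d : nat)
    (hF : #|F| = q) (hq : odd q) (hd : (2 <= d)%N)
    (R : {set F}) (hR : 0 \notin R) (Delta : nat) (hDelta : (2 <= Delta)%N)
    (t : nat) (ht : t = #|R|)
    (S : {set 'rV[F]_d}) (T : dist_graph R) (hT : is_tree T)
    (hdeg : forall r : F, r \in R -> (max_rdegree T r <= Delta)%N)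
    (hsize : #|T|%:R <= #|S|%:R
       - 30%:R * (t * Delta)%N%:R `^ (1 / 2%:R) * q%:R `^ ((d + 1)%N%:R / 2%:R) :> K) :
  contains_dist_graph T S.
Proof.
have [conn _] := hT; have T0 : (0 < #|T|)%N by case: conn.
(* Without colours the tree is a single vertex, and no cut-off m is needed. *)
have [t0|t_gt0] := posnP t.
  have R0 r : r \notin R by apply/negP => rR; move: t0; rewrite ht (cardD1 r) rR.
  have /card_gt0P[x xS] : (0 < #|S|)%N.
    rewrite -(ltr0n K); apply: lt_le_trans (_ : 0 < #|T|%:R) _; first by rewrite ltr0n.
    apply: le_trans hsize _; rewrite lerBlDr lerDl.
    by rewrite !mulr_ge0 ?powR_ge0 ?ler0n.
  exists (fun=> x); split=> // [u v _|u v /dlabel_in]; last by rewrite (negPf (R0 _)).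
  exact: tree_without_labels.
have q_gt0 : (0 < q)%N by rewrite -hF ltnW // finNzRing_gt1.
have leS : (#|S| <= q ^ d)%N by have := max_card S; rewrite card_mx mul1n hF.
have leD := (size_bound_nat 0 T0 leS q_gt0 t_gt0 hsize).1.
pose P m := (m ^ 2 * Delta <= t * q ^ d.+1)%N.
have P1 : P 1%N by rewrite /P exp1n mul1n.
have Pbound m : P m -> (m <= t * q ^ d.+1)%N.
  move=> Pm; apply: leq_trans Pm; rewrite -mulnn -mulnA.
  by case: m => // m; rewrite leq_pmulr // muln_gt0 /= (ltnW hDelta).
case: (@ex_maxnP P (t * q ^ d.+1)%N (ex_intro _ 1%N P1) Pbound) => m Pm max_m.
have m_gt0 : (0 < m)%N by apply: max_m.
have lt_m : (t * q ^ d.+1 < m.+1 ^ 2 * Delta)%N.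
  by rewrite ltnNge; apply/negP => /max_m; rewrite ltnn.
have size_nat := (size_bound_nat m T0 leS q_gt0 t_gt0 hsize).2 Pm.
pose N := @sphere_nbrs F d.
(* Maximality of m gives t q^(d+1) < (m+1)^2 Delta, so at most
   4 (m+1) Delta <= 8 m Delta vertices are missed. *)
have missed (X : {set 'rV[F]_d * F}) : X \subset setX S R -> (m < #|X|)%N ->
    (#|S :\: nbhd N X| <= 8 * (m * Delta))%N.
  move=> sX mX; have := sphere_nbhd_large (_ : odd #|F|) hR sX; rewrite hF -ht => /(_ hq) le4.
  have : (m.+1 * #|S :\: nbhd N X| < m.+1 * (4 * (m.+1 * Delta)))%N.
    apply: leq_ltn_trans (leq_mul mX (leqnn _)) (leq_ltn_trans le4 _).
    by rewrite [ltnRHS]mulnCA ltn_pmul2l // mulnA mulnn.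
  rewrite ltn_pmul2l // => /ltnW/leq_trans; apply.
  rewrite -[8%N]/(4 * 2)%N -mulnA leq_mul2l /= mulnA leq_mul2r.
  by apply/orP; right; move: m_gt0; clear; lia.
have mD : (m <= m * Delta)%N by rewrite leq_pmulr // (ltnW hDelta).
have roomy : (8 * (m * Delta) + 2 * m + Delta * (2 * m) < #|S|)%N.
  rewrite [(Delta * _)%N]mulnC -mulnA.
  by move: size_nat mD T0; move: (m * Delta)%N; clear; lia.
have [S' [sS' cS'] small] := exists_expanding_subset missed roomy.
have large : expanding (within N S') (setX S' R) Delta m (2 * m) #|T|.
  move=> X sX /andP[mX X2m]; rewrite nbhd_within.
  have sX' : X \subset setX S R by apply: subset_trans sX _; rewrite setXS.
  have cK : (#|S'| <= #|nbhd N X :&: S'| + 8 * (m * Delta))%N.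
    rewrite -(cardsID (nbhd N X) S') setIC leq_add2l.
    exact: leq_trans (subset_leq_card (setSD _ sS')) (missed X sX' mX).
  have := leq_mul (leqnn Delta) X2m; rewrite [(Delta * (2 * m))%N]mulnC -mulnA.
  move: cK cS' size_nat mD; move: (Delta * _)%N #|_ :&: _| (m * Delta)%N #|S'| #|S| #|T|.
  by clear; lia.
have S'0 : S' != set0.
  apply: contraTneq cS' => ->; rewrite cards0 -ltnNge.
  by apply: leq_ltn_trans roomy; clear; lia.
have within_sub p : within N S' p \subset S' by apply: subsetIr.
have within_sym x y r : x \in S' -> y \in within N S' (x, r) -> x \in within N S' (y, r).
  by move=> xS; rewrite !inE /= => /andP[e _]; rewrite xS -qnormN opprB e.
have rdeg r (v : T) : r \in R -> (#|[set u | adj v u & dlabel v u == r]| <= Delta)%N.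
  by move=> rR; apply: (leq_trans (@leq_bigmax _ (@Defs.rdegree F R T r) v) (hdeg r rR)).
have [phi [phi_inj phiS phiN]] := embed_tree (@dlabel_sym _ _ T) (@dlabel_in _ _ T)
  within_sub within_sym m_gt0 hT rdeg small large S'0.
exists phi; split=> // [v|u v /phiN]; first exact: subsetP (phiS v).
by rewrite !inE => /andP[/eqP].
Qed.
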